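(* Let $(H,\boldsymbol g)$ be a finite-dimensional pivotal quasi-Hopf algebra over an algebraically closed field $k$ and $A\subset H$ a unimodular quasi-Hopf subalgebra with $\boldsymbol g\in A$. Let $I(A)$ be the full subcategory of finite-dimensional left $H$-modules which are projective as $A$-modules, let $\widehat\lambda^A\in A^*$ be a right (left) symmetrised cointegral for $A$, with corresponding right (left) modified trace $\mathsf t^A$ on the ideal of projective $A$-modules. For $M\in I(A)$ let $\mathrm{Res}\,M$ be its restriction to $A$. Then the family of linear maps $$(\mathrm{Res}^*\mathsf t^A)_M:\mathrm{End}_H(M)\to k,\qquad(\mathrm{Res}^*\mathsf t^A)_M(f)=\mathsf t^A_{\mathrm{Res}M}(f),\qquad M\in I(A),$$ defines a right (left) modified trace on $I(A)$. Explicitly, $$(\mathrm{Res}^*\mathsf t^A)_M(f)=\sum_{i=1}^n\widehat\lambda^A\big((p_i\circ f\circ j_i)(\mathbf 1_A)\big),$$ where $\mathbf 1_A$ is the unit of $A$, $n$ is a natural number and $p_i:\mathrm{Res}M\to A$, $j_i:A\to\mathrm{Res}M$ are $A$-module morphisms, $i=1,\dots,n$, such that $\sum_{i=1}^nj_i\circ p_i=\mathrm{id}_M$ and $p_l\circ j_m=\delta_{l,m}\,p_l\circ j_l$.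
   Context: A quasi-Hopf algebra $H$ has coproduct $\Delta$, counit $\varepsilon$, coassociator $\Phi\in H^{\otimes3}$ with inverse $\Psi$, satisfying $(\Delta\otimes\mathrm{id})\Delta(h)\cdot\Phi=\Phi\cdot(\mathrm{id}\otimes\Delta)\Delta(h)$ and the usual normalisation and cocycle conditions, and an antipode $S$ with elements $\boldsymbol\alpha,\boldsymbol\beta$: $S(h_{(1)})\boldsymbol\alpha h_{(2)}=\varepsilon(h)\boldsymbol\alpha$, $h_{(1)}\boldsymbol\beta S(h_{(2)})=\varepsilon(h)\boldsymbol\beta$, $S(\Phi_1)\boldsymbol\alpha\Phi_2\boldsymbol\beta S(\Phi_3)=1=\Psi_1\boldsymbol\beta S(\Psi_2)\boldsymbol\alpha\Psi_3$. Finite-dimensional left modules form a finite tensor category (associator $U(VW)\to(UV)W$ acts by $\Phi$; dual $V^*$ with $(h.f)(v)=f(S(h)v)$, $\mathrm{ev}(f\otimes v)=f(\boldsymbol\alpha v)$, $\mathrm{coev}(1)=\sum\boldsymbol\beta v_i\otimes v^i$). A pivot is an invertible $\boldsymbol g$ with $S^2(h)=\boldsymbol gh\boldsymbol g^{-1}$ and $\Delta(\boldsymbol g)=\boldsymbol f^{-1}(S\otimes S)(\boldsymbol f_{21})(\boldsymbol g\otimes\boldsymbol g)$, $\boldsymbol f$ the Drinfeld twist (implementing $W^\vee\otimes V^\vee\cong(V\otimes W)^\vee$); equivalently, it defines a pivotal structure on the module category, with $\widetilde{\mathrm{ev}}(v\otimes f)=f(S(\boldsymbol\alpha)\boldsymbol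 gv)$, $\widetilde{\mathrm{coev}}(1)=\sum v^i\otimes S^{-1}(\boldsymbol g\boldsymbol\beta)v_i$. Unimodular: left integrals ($c$ with $hc=\varepsilon(h)c$) are also right integrals. A quasi-Hopf subalgebra $A\subset H$ is a unital subalgebra with $\Delta(A)\subset A\otimes A$, $S(A)\subset A$, $\Phi\in A^{\otimes3}$ (and $\boldsymbol\alpha,\boldsymbol\beta\in A$), so that $A$ with the restricted structure is a quasi-Hopf algebra; with $\boldsymbol g\in A$ it is pivotal. Right/left tensor ideal: full subcategory closed under tensoring from the right/left with arbitrary objects and under retracts. $I(A)$ is a tensor ideal. A right modified trace on $\mathcal I$: linear maps $\mathsf t_X:\mathrm{End}(X)\to k$, $X\in\mathcal I$, with $\mathsf t_X(gf)=\mathsf t_Y(fg)$ for $f:X\to Y$, $g:Y\to X$, and $\mathsf t_{X\otimes V}(f)=\mathsf t_X$ of the right partial trace $(\mathrm{id}_X\otimes\widetilde{\mathrm{ev}}_V)(f\otimes\mathrm{id}_{V^\vee})(\mathrm{id}_X\otimes\mathrm{coev}_V)$ (associators suppressed); left modified traces use instead left partial traces. Symmetrised cointegrals of a unimodular pivotal quasi-Hopf algebra $A$: with $q^R=\Psi_1\otimes S^{-1}(\boldsymbol\alpha\Psi_3)\Psi_2$, $p^R=\Phi_1\otimes\Phi_2\boldsymbol\beta S(\Phi_3)$, $q^L=S(\Phi_1)\boldsymbol\alpha\Phi_2\otimes\Phi_3$, $p^L=\Psi_2S^{-1}(\Psi_1\boldsymbol\beta)\otimes\Psi_3$, a right (left)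 symmetrised cointegral is a non-zero linear form $\widehat\lambda$ with $(\widehat\lambda\otimes\mathrm{id})(q^R\Delta(h)p^R)=\widehat\lambda(h)\boldsymbol g^{-1}$ (resp. $(\mathrm{id}\otimes\widehat\lambda)(q^L\Delta(h)p^L)=\widehat\lambda(h)\boldsymbol g$) for all $h\in A$. It is known that these are unique up to scalar and correspond bijectively to non-degenerate right (left) modified traces on projective $A$-modules via $\mathsf t_P(f)=\widehat\lambda((i\circ f\circ p)(\mathbf 1_A))$ for a direct summand $A\xrightarrow{p}P\xrightarrow{i}A$, $p\circ i=\mathrm{id}_P$. *)

(* Defs.v *)
From HB Require Import structures.
From mathcomp Require Import all_boot all_order all_algebra all_field.

Set Implicit Arguments.
Unset Strict Implicit.
Unset Printing Implicit Defensive.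

Import GRing.Theory.
Local Open Scope ring_scope.

(* Tensor products of finite-dimensional vector spaces, written in coordinates
   with respect to the bases [vbasis fullv] of the factors. *)
Record tens (k : fieldType) (U V : vectType k) : Type :=
  Tens { tens_mx : 'M[k]_(\dim {:U}, \dim {:V}) }.

Section TensorSpace.
Variables (k : fieldType) (U V : vectType k).
Implicit Types x y z : tens U V.

HB.instance Definition _ := [isNew for @tens_mx k U V].
HB.instance Definition _ := [Choice of tens U V by <:].

Lemma tens_mxK : cancel (@tens_mx k U V) (@Tens k U V).
Proof. by case. Qed.

Definition tens_zero := @Tens k U V 0.
Definition tens_opp x := @Tens k U V (- tens_mx x).
Definition tens_add x y := @Tens k U V (tens_mx x + tens_mx y).
Definition tens_scale c x := @Tens k U V (c *: tens_mx x).

Fact tens_addA : associative tens_add.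
Proof. by move=> x y z; congr Tens; rewrite addrA. Qed.
Fact tens_addC : commutative tens_add.
Proof. by move=> x y; congr Tens; rewrite addrC. Qed.
Fact tens_add0 : left_id tens_zero tens_add.
Proof. by case=> x; congr Tens; rewrite add0r. Qed.
Fact tens_addN : left_inverse tens_zero tens_opp tens_add.
Proof. by move=> x; congr Tens; rewrite addNr. Qed.

HB.instance Definition _ := GRing.isZmodule.Build (tens U V)
  tens_addA tens_addC tens_add0 tens_addN.

Fact tens_scaleA a b x : tens_scale a (tens_scale b x) = tens_scale (a * b) x.
Proof. by congr Tens; rewrite scalerA. Qed.
Fact tens_scale1 : left_id 1 tens_scale.
Proof. by case=> x; congr Tens; rewrite scale1r. Qed.
Fact tens_scaleDr : right_distributive tens_scale +%R.
Proof. by move=> c x y; congr Tens; rewrite scalerDr. Qed.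
Fact tens_scaleDl x : {morph tens_scale^~ x : a b / a + b}.
Proof. by move=> a b; congr Tens; rewrite scalerDl. Qed.

HB.instance Definition _ := GRing.Zmodule_isLmodule.Build k (tens U V)
  tens_scaleA tens_scale1 tens_scaleDr tens_scaleDl.

Lemma tens_mx_linear : linear (@tens_mx k U V).
Proof. by []. Qed.

HB.instance Definition _ := GRing.isLinear.Build k (tens U V) _ _
  (@tens_mx k U V) tens_mx_linear.

Fact tens_vect_iso : Vector.axiom (\dim {:U} * \dim {:V}) (tens U V).
Proof.
exists (fun x => mxvec (tens_mx x)) => [c x y|]; first by rewrite !linearP.
exists (fun r => Tens (vec_mx r)) => [x|r] /=; last exact: vec_mxK.
by rewrite mxvecK tens_mxK.
Qed.

HB.instance Definition _ := Lmodule_hasFinDim.Build k (tens U V)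
  tens_vect_iso.

Lemma tens_eqP x y : (forall i j, tens_mx x i j = tens_mx y i j) -> x = y.
Proof. by move=> exy; apply: (can_inj tens_mxK); apply/matrixP. Qed.

End TensorSpace.

Section TensorDef.
Variables (k : fieldType) (U V : vectType k).

Definition tpure (u : U) (v : V) : tens U V :=
  Tens (\matrix_(i, j) (coord (vbasis {:U}) i u * coord (vbasis {:V}) j v)).

(* The linear map out of the tensor product induced by F; it is the one
   characterised by [tlift F (u ⊗ v) = F u v] as soon as F is bilinear
   (lemma [tlift_pure]), which is the case everywhere below. *)
Definition tlift (W : lmodType k) (F : U -> V -> W) (x : tens U V) : W :=
  \sum_i \sum_j tens_mx x i j *: F (vbasis {:U})`_i (vbasis {:V})`_j.

End TensorDef.

Notation "u ⊗ v" := (tpure u v) (at level 40, left associativity) : ring_scope.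

(* Sweedler-style sums: E is bilinear (trilinear) in the bound variables. *)
Notation "'\sw_' ( a , b <- x ) E" := (tlift (fun a b => E) x)
  (at level 41, a name, b name, x at level 60, E at level 41,
   format "\sw_ ( a ,  b  <-  x )  E") : ring_scope.
Notation "'\sw_' ( a , b , c <- x ) E" :=
  (tlift (fun t c => tlift (fun a b => E) t) x)
  (at level 41, a name, b name, c name, x at level 60, E at level 41,
   format "\sw_ ( a ,  b ,  c  <-  x )  E") : ring_scope.

Section TensorTheory.
Variables (k : fieldType) (U V : vectType k).
Implicit Types (u : U) (v : V) (x : tens U V).

Lemma tpureDZl v c u u' : (c *: u + u') ⊗ v = c *: (u ⊗ v) + u' ⊗ v.
Proof. by apply: tens_eqP => i j; rewrite !mxE linearP mulrDl /= mulrA. Qed.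

Lemma tpureDZr u c v v' : u ⊗ (c *: v + v') = c *: (u ⊗ v) + u ⊗ v'.
Proof. by apply: tens_eqP => i j; rewrite !mxE linearP mulrDr /= mulrCA. Qed.

Lemma tlift_linear (W : lmodType k) (F : U -> V -> W) : linear (tlift F).
Proof.
move=> c x y; rewrite /tlift scaler_sumr -big_split; apply: eq_bigr => i _ /=.
rewrite scaler_sumr -big_split; apply: eq_bigr => j _ /=.
by rewrite !mxE scalerDl scalerA.
Qed.

HB.instance Definition _ (W : lmodType k) (F : U -> V -> W) :=
  GRing.isLinear.Build k (tens U V) W _ (tlift F) (tlift_linear F).

Definition bilin (W : lmodType k) (F : U -> V -> W) :=
  (forall v, linear (F^~ v)) /\ (forall u, linear (F u)).

Lemma bilin_tpure : bilin (@tpure k U V).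
Proof. by split=> w c a b; rewrite ?tpureDZl ?tpureDZr. Qed.

Lemma bilin_sum (W : lmodType k) (F : U -> V -> W) : bilin F -> forall u v,
  F u v = \sum_i \sum_j (coord (vbasis {:U}) i u * coord (vbasis {:V}) j v)
            *: F (vbasis {:U})`_i (vbasis {:V})`_j.
Proof.
case=> Fl Fr u v.
have linS (W1 : lmodType k) (G : W1 -> W) : linear G -> forall n (c : 'I_n -> k) w,
    G (\sum_i c i *: w i) = \sum_i c i *: G (w i).
  move=> lG n c w; pose GL : {linear W1 -> W} :=
    HB.pack G (GRing.isLinear.Build k W1 W _ G lG).
  rewrite -[G]/(GL : W1 -> W) linear_sum; apply: eq_bigr => i _.
  by rewrite linearZ.
rewrite [u in LHS](coord_vbasis (memvf u)) (linS _ (F^~ v) (Fl v)).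
apply: eq_bigr => i _.
rewrite [v in LHS](coord_vbasis (memvf v)) (linS _ _ (Fr _)) scaler_sumr.
by apply: eq_bigr => j _; rewrite scalerA.
Qed.

Lemma tlift_pure (W : lmodType k) (F : U -> V -> W) :
  bilin F -> forall u v, \sw_(a, b <- u ⊗ v) F a b = F u v.
Proof.
move=> bF u v; rewrite [RHS](bilin_sum bF); apply: eq_bigr => i _.
by apply: eq_bigr => j _; rewrite mxE.
Qed.

Lemma tlift_comp (W W' : lmodType k) (L : {linear W -> W'})
  (F : U -> V -> W) x : L (\sw_(a, b <- x) F a b) = \sw_(a, b <- x) L (F a b).
Proof.
rewrite linear_sum; apply: eq_bigr => i _; rewrite linear_sum.
by apply: eq_bigr => j _; rewrite linearZ.
Qed.

Lemma eq_tlift (W : lmodType k) (F G : U -> V -> W) x :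
  F =2 G -> tlift F x = tlift G x.
Proof.
by move=> eFG; apply: eq_bigr => i _; apply: eq_bigr => j _; rewrite eFG.
Qed.

Lemma tlift_id x : \sw_(a, b <- x) a ⊗ b = x.
Proof.
apply: tens_eqP => p q; rewrite raddf_sum summxE (bigD1 p) //= [X in _ + X]big1 => [|i nip].
  rewrite addr0 raddf_sum summxE (bigD1 q) //= [X in _ + X]big1 => [|j njq].
    by rewrite !mxE !coord_free ?(basis_free (vbasisP _)) ?eqxx ?mulr1 ?addr0.
  rewrite !mxE !coord_free ?(basis_free (vbasisP _)) //.
  by rewrite eqxx mul1r [_ == _](negbTE njq) mulr0.
rewrite raddf_sum summxE big1 // => j _; rewrite !mxE !coord_free ?(basis_free (vbasisP _)) //.
by rewrite [_ == _](negbTE nip) mul0r mulr0.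
Qed.

Lemma tens_ext (W : lmodType k) (L L' : {linear tens U V -> W}) :
  (forall u v, L (u ⊗ v) = L' (u ⊗ v)) -> L =1 L'.
Proof.
by move=> eL x; rewrite -(tlift_id x) !tlift_comp; apply: eq_tlift.
Qed.

Lemma tens_lin_ext (W : lmodType k) (L L' : tens U V -> W) :
  linear L -> linear L' -> (forall u v, L (u ⊗ v) = L' (u ⊗ v)) -> L =1 L'.
Proof.
move=> lL lL'; pose LL : {linear tens U V -> W} :=
  HB.pack L (GRing.isLinear.Build k _ _ _ L lL).
pose LL' : {linear tens U V -> W} :=
  HB.pack L' (GRing.isLinear.Build k _ _ _ L' lL').
exact: (@tens_ext _ LL LL').
Qed.

Lemma tlift_param (W W' : lmodType k) (G : W' -> U -> V -> W) x :
  (forall u v, linear (fun w => G w u v)) ->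
  linear (fun w => \sw_(u, v <- x) G w u v).
Proof.
move=> lG c w w'; rewrite /tlift scaler_sumr -big_split.
apply: eq_bigr => i _; rewrite scaler_sumr -big_split; apply: eq_bigr => j _.
by rewrite lG scalerDr !scalerA /= mulrC.
Qed.

End TensorTheory.

Definition tmap (k : fieldType) (U V U' V' : vectType k)
    (f : 'Hom(U, U')) (g : 'Hom(V, V')) : 'Hom(tens U V, tens U' V') :=
  linfun (fun x => \sw_(u, v <- x) f u ⊗ g v).

Section TensorMaps.
Variable k : fieldType.
Implicit Types U V W : vectType k.

Lemma bilin_comp U V (U' V' : vectType k) (W : lmodType k) (F : U' -> V' -> W)
    (f : {linear U -> U'}) (g : {linear V -> V'}) :
  bilin F -> bilin (fun u v => F (f u) (g v)).
Proof.
by case=> Fl Fr; split=> w c a b; rewrite linearP; [exact: Fl | exact: Fr].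
Qed.

Lemma bilin_lin U V (W W' : lmodType k) (F : U -> V -> W)
    (L : {linear W -> W'}) : bilin F -> bilin (fun u v => L (F u v)).
Proof.
case=> Fl Fr; split=> w c a b; [move: (Fl w c a b) | move: (Fr w c a b)];
  by move=> /= ->; rewrite linearP.
Qed.

Lemma tmapE U V U' V' (f : 'Hom(U, U')) (g : 'Hom(V, V')) x :
  tmap f g x = \sw_(u, v <- x) f u ⊗ g v.
Proof. by rewrite /tmap lfunE. Qed.

Lemma tmap_pure U V U' V' (f : 'Hom(U, U')) (g : 'Hom(V, V')) u v :
  tmap f g (u ⊗ v) = f u ⊗ g v.
Proof.
by rewrite tmapE tlift_pure //; apply: bilin_comp; apply: bilin_tpure.
Qed.

Lemma tlift_tmap U V U' V' (W : lmodType k) (F : U' -> V' -> W)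
    (f : 'Hom(U, U')) (g : 'Hom(V, V')) x : bilin F ->
  \sw_(a, b <- tmap f g x) F a b = \sw_(a, b <- x) F (f a) (g b).
Proof.
move=> bF; rewrite tmapE tlift_comp; apply: eq_tlift => u v /=.
by rewrite tlift_pure.
Qed.

End TensorMaps.

(* The algebra H ⊗ K, with (a ⊗ b) (c ⊗ d) = a c ⊗ b d. *)
Section TensorAlgebra.
Variables (k : fieldType) (H K : falgType k).
Implicit Types x y z : tens H K.

Definition tmul x y : tens H K :=
  \sw_(a, b <- x) \sw_(c, d <- y) ((a * c) ⊗ (b * d)).

Lemma bilin_mul (a : H) (b : K) : bilin (fun c d => (a * c) ⊗ (b * d)).
Proof. by split=> w c u v; rewrite mulrDr -scalerAr ?tpureDZl ?tpureDZr. Qed.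

Lemma bilin_tmul y :
  bilin (fun a b => \sw_(c, d <- y) ((a * c : H) ⊗ (b * d : K))).
Proof.
by split=> w; apply: tlift_param => u v c a b;
  rewrite mulrDl -scalerAl ?tpureDZl ?tpureDZr.
Qed.

Lemma tmul_pure a b c d : tmul (a ⊗ b) (c ⊗ d) = (a * c) ⊗ (b * d).
Proof.
by rewrite /tmul (tlift_pure (bilin_tmul _)) (tlift_pure (bilin_mul _ _)).
Qed.

Lemma tmul_linearl y : linear (tmul^~ y).
Proof. exact: tlift_linear. Qed.

Lemma tmul_linearr x : linear (tmul x).
Proof. by apply: tlift_param => a b; apply: tlift_linear. Qed.

Lemma tmulA : associative tmul.
Proof.
move=> x y z; move: x; apply: tens_lin_ext => [||a b].
- exact: tmul_linearl.
- by move=> c u v; rewrite !tmul_linearl.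
move: y; apply: tens_lin_ext => [||c d].
- by move=> e u v; rewrite tmul_linearl tmul_linearr.
- by move=> e u v; rewrite tmul_linearr tmul_linearl.
move: z; apply: tens_lin_ext => [||e f].
- by move=> w u v; rewrite !tmul_linearr.
- exact: tmul_linearr.
by rewrite !tmul_pure !mulrA.
Qed.

Lemma tmul1l : left_id (1 ⊗ 1) tmul.
Proof.
apply: tens_lin_ext => [||a b] //; first exact: tmul_linearr.
by rewrite tmul_pure !mul1r.
Qed.

Lemma tmul1r : right_id (1 ⊗ 1) tmul.
Proof.
apply: tens_lin_ext => [||a b] //; first exact: tmul_linearl.
by rewrite tmul_pure !mulr1.
Qed.

Lemma tmulDl : left_distributive tmul +%R.
Proof. by move=> x y z; rewrite -[x]scale1r tmul_linearl !scale1r. Qed.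

Lemma tmulDr : right_distributive tmul +%R.
Proof. by move=> x y z; rewrite -[y]scale1r tmul_linearr !scale1r. Qed.

Lemma tpure11_neq0 : 1 ⊗ 1 != 0 :> tens H K.
Proof.
have nz1 (L : falgType k) : exists i, coord (vbasis {:L}) i 1 != 0.
  apply/existsP; apply: contraT => /existsPn c0; have := oner_neq0 L.
  rewrite [X in X != 0](coord_vbasis (memvf 1)) big1 ?eqxx // => i _.
  by have /negPn/eqP-> := c0 i; rewrite scale0r.
have [[i nzi] [j nzj]] := (nz1 H, nz1 K).
apply/eqP=> /(congr1 (fun x => tens_mx x i j)); rewrite !mxE => /eqP.
by rewrite mulf_eq0 (negbTE nzi) (negbTE nzj).
Qed.

HB.instance Definition _ := GRing.Zmodule_isNzRing.Build (tens H K)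
  tmulA tmul1l tmul1r tmulDl tmulDr tpure11_neq0.

Lemma tmulZl (c : k) x y : c *: (x * y) = (c *: x) * y.
Proof.
have E := tmul_linearl y c x 0; have Z : tmul 0 y = 0 := mul0r y.
by rewrite /= Z !addr0 in E.
Qed.

Lemma tmulZr (c : k) x y : c *: (x * y) = x * (c *: y).
Proof.
have E := tmul_linearr x c y 0; have Z : tmul x 0 = 0 := mulr0 x.
by rewrite Z !addr0 in E.
Qed.

HB.instance Definition _ := GRing.Lmodule_isLalgebra.Build k (tens H K) tmulZl.
HB.instance Definition _ := GRing.Lalgebra_isAlgebra.Build k (tens H K) tmulZr.
HB.instance Definition _ := Algebra_isFalgebra.Build k (tens H K).

Lemma tens_mulE (a c : H) (b d : K) : (a ⊗ b) * (c ⊗ d) = (a * c) ⊗ (b * d).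
Proof. exact: tmul_pure. Qed.

End TensorAlgebra.

Section AlgebraMaps.
Variables (k : fieldType) (H K H' K' : falgType k).
Variables (f : 'Hom(H, H')) (g : 'Hom(K, K')).

Lemma tmapM : {morph f : x y / x * y} -> {morph g : x y / x * y} ->
  {morph tmap f g : x y / x * y}.
Proof.
move=> fM gM x y; move: x; apply: tens_lin_ext => [c u v|c u v|a b].
- by rewrite mulrDl -scalerAl linearP.
- by rewrite linearP mulrDl -scalerAl.
move: y; apply: tens_lin_ext => [c' u v|c' u v|c d].
- by rewrite mulrDr -scalerAr linearP.
- by rewrite linearP mulrDr -scalerAr.
by rewrite !(tens_mulE, tmap_pure) fM gM.
Qed.

Lemma tmap1 : f 1 = 1 -> g 1 = 1 -> tmap f g 1 = 1.
Proof. by move=> f1 g1; rewrite [LHS]tmap_pure f1 g1. Qed.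

Lemma tmapK (f' : 'Hom(H', H)) (g' : 'Hom(K', K)) :
  cancel f f' -> cancel g g' -> cancel (tmap f g) (tmap f' g').
Proof.
move=> fK gK x.
move: x; apply: tens_lin_ext => [c u v||a b] //; first by rewrite !linearP.
by rewrite !tmap_pure fK gK.
Qed.

End AlgebraMaps.

Section Linearity.
Variable k : fieldType.
Implicit Types (W : lmodType k) (U V : vectType k) (A : falgType k).

Lemma lin_id W : linear (fun x : W => x).
Proof. by []. Qed.

Lemma lin_app W W' W'' (L : {linear W' -> W''}) (f : W -> W') :
  linear f -> linear (fun x => L (f x)).
Proof. by move=> lf c x y; rewrite lf linearP. Qed.

Lemma lin_scalel W W' (f : W -> k^o) (w : W') :
  linear f -> linear (fun x => f x *: w).
Proof. by move=> lf c x y; rewrite lf scalerDl -scalerA. Qed.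

Lemma lin_scaler W W' (e : k) (f : W -> W') :
  linear f -> linear (fun x => e *: f x).
Proof. by move=> lf c x y; rewrite lf scalerDr !scalerA mulrC. Qed.

Lemma lin_mull W A (f : W -> A) a : linear f -> linear (fun x => f x * a).
Proof. by move=> lf c x y; rewrite lf mulrDl -scalerAl. Qed.

Lemma lin_mulr W A (f : W -> A) a : linear f -> linear (fun x => a * f x).
Proof. by move=> lf c x y; rewrite lf mulrDr -scalerAr. Qed.

Lemma lin_tpurel W U V (f : W -> U) (v : V) :
  linear f -> linear (fun x => f x ⊗ v).
Proof. by move=> lf c x y; rewrite lf tpureDZl. Qed.

Lemma lin_tpurer W U V (u : U) (f : W -> V) :
  linear f -> linear (fun x => u ⊗ f x).
Proof. by move=> lf c x y; rewrite lf tpureDZr. Qed.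

Lemma lin_sw W W' U V (F : U -> V -> W') (f : W -> tens U V) :
  linear f -> linear (fun x => tlift F (f x)).
Proof. by move=> lf c x y; rewrite lf linearP. Qed.

Lemma lin_sw' W W' U V (G : W' -> U -> V -> W) x :
  (forall u v, linear (fun w => G w u v)) -> linear (fun w => tlift (G w) x).
Proof. exact: tlift_param. Qed.

End Linearity.

Ltac lin := first
  [ exact: lin_id
  | apply: lin_tpurel; lin | apply: lin_tpurer; lin
  | apply: lin_mull; lin | apply: lin_mulr; lin
  | apply: lin_scalel; lin | apply: lin_scaler; lin
  | apply: lin_sw; lin
  | apply: lin_sw' => ? ?; lin
  | apply: lin_app; lin ].

Ltac bilin := split=> ?; lin.

Section Naturality.
Variables (k : fieldType) (U V U' V' : vectType k) (W W' : lmodType k).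
Variables (f : 'Hom(U, U')) (g : 'Hom(V, V')) (L : {linear W -> W'}).

Lemma sw_nat (F : U -> V -> W) (F' : U' -> V' -> W') x y : bilin F' ->
  tmap f g x = y -> (forall a b, L (F a b) = F' (f a) (g b)) ->
  L (\sw_(a, b <- x) F a b) = \sw_(a, b <- y) F' a b.
Proof.
move=> bF' <- eF; rewrite tlift_comp tlift_tmap //.
exact: eq_tlift.
Qed.

End Naturality.

Lemma sw3_nat (k : fieldType) (U V T U' V' T' : vectType k) (W W' : lmodType k)
    (f : 'Hom(U, U')) (g : 'Hom(V, V')) (h : 'Hom(T, T')) (L : {linear W -> W'})
    (F : U -> V -> T -> W) (F' : U' -> V' -> T' -> W') x y :
  (forall c, bilin (fun a b => F' a b c)) -> (forall a b, linear (F' a b)) ->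
  tmap (tmap f g) h x = y ->
  (forall a b c, L (F a b c) = F' (f a) (g b) (h c)) ->
  L (\sw_(a, b, c <- x) F a b c) = \sw_(a, b, c <- y) F' a b c.
Proof.
move=> bF lF e eF; apply: sw_nat e _.
  split=> t; first exact: tlift_linear.
  by apply: tlift_param => a b; apply: lF.
by move=> t c; apply: sw_nat.
Qed.

(* In finite dimension, invertibility is detected by injective morphisms. *)
Lemma unit_inj (k : fieldType) (B C : falgType k) (T : 'Hom(B, C)) (b : B) :
  injective T -> {morph T : x y / x * y} -> T 1 = 1 ->
  T b \is a GRing.unit -> b \is a GRing.unit /\ T b^-1 = (T b)^-1.
Proof.
move=> injT TM T1 uTb.
have amlE (u v : B) : amull u v = u * v by rewrite lfunE.
have kb : lker (amull b) == 0%VS.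
  apply/lker0P=> x y; rewrite !amlE => /(congr1 T); rewrite !TM => e.
  by apply: injT; apply: (mulrI uTb).
have [y by1] : exists y, b * y = 1.
  by exists ((amull b)^-1%VF 1); rewrite -amlE lker0_lfunVK.
have yb1 : y * b = 1.
  apply: injT; rewrite TM T1; apply: (mulrI uTb).
  by rewrite mulrA -TM by1 T1 mul1r mulr1.
have ub : b \is a GRing.unit by apply/unitrP; exists y.
by split=> //; apply: (mulrI uTb); rewrite -TM !mulrV.
Qed.

(* Sweedler notation: h_(1) ⊗ h_(2) = Δ h, Φ_1 ⊗ Φ_2 ⊗ Φ_3 = Φ, and
   H^{⊗3} = (H ⊗ H) ⊗ H, H^{⊗4} = ((H ⊗ H) ⊗ H) ⊗ H. *)
Record quasiHopf (k : fieldType) := QuasiHopf {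
  qh_alg :> falgType k;
  qh_Delta : 'Hom(qh_alg, tens qh_alg qh_alg);
  qh_eps : 'Hom(qh_alg, k^o);
  qh_Phi : tens (tens qh_alg qh_alg) qh_alg;
  qh_S : 'End(qh_alg);
  qh_alpha : qh_alg;
  qh_beta : qh_alg;
  qh_Delta1 : qh_Delta 1 = 1;
  qh_DeltaM : {morph qh_Delta : h h' / h * h'};
  qh_eps1 : qh_eps 1 = 1;
  qh_epsM : {morph qh_eps : h h' / h * h'};
  qh_counitl : forall h, \sw_(a, b <- qh_Delta h) (qh_eps a *: b) = h;
  qh_counitr : forall h, \sw_(a, b <- qh_Delta h) (qh_eps b *: a) = h;
  qh_Phi_unit : qh_Phi \is a GRing.unit;
  qh_coassoc : forall h,
    (\sw_(a, b <- qh_Delta h) (qh_Delta a ⊗ b)) * qh_Phi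
    = qh_Phi * (\sw_(a, b <- qh_Delta h) \sw_(c, d <- qh_Delta b) (a ⊗ c ⊗ d));
  qh_normal : \sw_(a, b, c <- qh_Phi)
    ((qh_eps b : k) *: (a ⊗ c)) = 1 :> tens qh_alg qh_alg;
  (* (Δ ⊗ id ⊗ id)(Φ) (id ⊗ id ⊗ Δ)(Φ) = (Φ ⊗ 1) (id ⊗ Δ ⊗ id)(Φ) (1 ⊗ Φ),
     the pentagon for the associators U(VW) -> (UV)W given by Φ *)
  qh_cocycle :
    (\sw_(a, b, c <- qh_Phi) (qh_Delta a ⊗ b ⊗ c)) *
    (\sw_(a, b, c <- qh_Phi) \sw_(d, e <- qh_Delta c) (a ⊗ b ⊗ d ⊗ e))
    = (qh_Phi ⊗ 1) *
      (\sw_(a, b, c <- qh_Phi) \sw_(d, e <- qh_Delta b) (a ⊗ d ⊗ e ⊗ c)) *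
      (\sw_(a, b, c <- qh_Phi) (1 ⊗ a ⊗ b ⊗ c));
  qh_S1 : qh_S 1 = 1;
  qh_SM : forall a b, qh_S (a * b) = qh_S b * qh_S a;
  qh_S_bij : bijective qh_S;
  qh_antipodel : forall h,
    \sw_(a, b <- qh_Delta h) (qh_S a * qh_alpha * b) = qh_eps h *: qh_alpha;
  qh_antipoder : forall h,
    \sw_(a, b <- qh_Delta h) (a * qh_beta * qh_S b) = qh_eps h *: qh_beta;
  qh_zigzag :
    \sw_(a, b, c <- qh_Phi) (qh_S a * qh_alpha * b * qh_beta * qh_S c) = 1;
  qh_zigzag' :
    \sw_(a, b, c <- qh_Phi^-1) (a * qh_beta * qh_S b * qh_alpha * c) = 1
}.

Local Notation Δ := (qh_Delta _).
Local Notation ε := (qh_eps _).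
Local Notation Φ := (qh_Phi _).
Local Notation Ψ := ((qh_Phi _)^-1).
Local Notation S := (qh_S _).
Local Notation Sinv := ((qh_S _)^-1)%VF.
Local Notation α := (qh_alpha _).
Local Notation β := (qh_beta _).

Section QuasiHopf.
Variables (k : fieldType) (H : quasiHopf k).
Implicit Types (h : H) (x : tens H H).

(* The Drinfeld twist, characterised by
   f Δ(S(h)) f^-1 = (S ⊗ S)(Δ^cop(h)) and f Δ(α) = γ. *)

(* (1 ⊗ Φ) (id ⊗ id ⊗ Δ)(Ψ) *)
Definition twist_aux : tens (tens (tens H H) H) H :=
  (\sw_(a, b, c <- Φ) (1 ⊗ a ⊗ b ⊗ c)) *
  (\sw_(a, b, c <- Ψ) \sw_(d, e <- Δ c) (a ⊗ b ⊗ d ⊗ e)).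

Definition twist_gamma : tens H H :=
  \sw_(x, d <- twist_aux) \sw_(a, b, c <- x)
    ((S b * α * c) ⊗ (S a * α * d)).

Definition tflip x : tens H H := \sw_(a, b <- x) (b ⊗ a).

Definition drinfeld_twist : tens H H :=
  \sw_(a, b, c <- Φ)
    (tmap S S (tflip (Δ a)) * twist_gamma * Δ (b * β * S c)).

Record is_pivot (g : H) : Prop := IsPivot {
  pivot_unit : g \is a GRing.unit;
  pivot_S2 : forall h, S (S h) = g * h * g^-1;
  pivot_Delta : Δ g =
    drinfeld_twist^-1 * tmap S S (tflip drinfeld_twist) * (g ⊗ g)
}.

Definition left_integral (c : H) := forall h, h * c = ε h *: c.
Definition right_integral (c : H) := forall h, c * h = ε h *: c.
Definition unimodular := forall c, left_integral c -> right_integral c.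

Definition qR : tens H H := \sw_(a, b, c <- Ψ) (a ⊗ (Sinv (α * c) * b)).
Definition pR : tens H H := \sw_(a, b, c <- Φ) (a ⊗ (b * β * S c)).
Definition qL : tens H H := \sw_(a, b, c <- Φ) ((S a * α * b) ⊗ c).
Definition pL : tens H H := \sw_(a, b, c <- Ψ) ((b * Sinv (a * β)) ⊗ c).

Definition right_sym_cointegral (g : H) (l : 'Hom(H, k^o)) :=
  l != 0 /\
  forall h, \sw_(a, b <- qR * Δ h * pR) (l a *: b) = l h *: g^-1.

Definition left_sym_cointegral (g : H) (l : 'Hom(H, k^o)) :=
  l != 0 /\
  forall h, \sw_(a, b <- qL * Δ h * pL) (l b *: a) = l h *: g.

End QuasiHopf.

(* The inclusion of a subspace, and the projection onto it. *)
Definition incl (k : fieldType) (V : vectType k) (A : {vspace V}) :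
  'Hom(subvs_of A, V) := linfun vsval.
Definition retr (k : fieldType) (V : vectType k) (A : {vspace V}) :
  'Hom(V, subvs_of A) := linfun (@vsproj k V A).

(* A ⊗ A and A ⊗ A ⊗ A are identified with their images in H ⊗ H and
   H ⊗ H ⊗ H. *)
Record subQuasiHopf (k : fieldType) (H : quasiHopf k) := SubQuasiHopf {
  sq_alg :> {aspace H};
  sq_1 : 1 \in sq_alg;
  sq_Delta : forall a, a \in sq_alg ->
    Δ a \in limg (tmap (incl sq_alg) (incl sq_alg));
  sq_S : forall a, a \in sq_alg -> S a \in sq_alg;
  sq_Phi : Φ \in
    limg (tmap (tmap (incl sq_alg) (incl sq_alg)) (incl sq_alg));
  sq_alpha : qh_alpha H \in sq_alg;
  sq_beta : qh_beta H \in sq_alg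
}.

Section Restriction.
Variables (k : fieldType) (H : quasiHopf k) (A : subQuasiHopf H).

Local Notation B := (subvs_of A : falgType k).
Local Notation ι := (incl A).
Local Notation π := (retr A).

Definition rs_Delta : 'Hom(B, tens B B) :=
  linfun (tmap π π \o Δ \o vsval).
Definition rs_eps : 'Hom(B, k^o) := linfun (ε \o vsval).
Definition rs_Phi : tens (tens B B) B := tmap (tmap π π) π Φ.
Definition rs_S : 'End(B) := linfun (vsproj A \o S \o vsval).
Definition rs_alpha : B := vsproj A α.
Definition rs_beta : B := vsproj A β.

Local Notation ι2 := (tmap ι ι).
Local Notation ι3 := (tmap ι2 ι).
Local Notation ι4 := (tmap ι3 ι).

Lemma inclE a : ι a = vsval a. Proof. by rewrite lfunE. Qed.

Lemma inclK : cancel ι π.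
Proof. by move=> a; rewrite !lfunE /= vsvalK. Qed.

Lemma retrK (a : H) : a \in (A : {vspace H}) -> ι (π a) = a.
Proof. by move=> Aa; rewrite !lfunE /= vsprojK. Qed.

Lemma incl1 : ι 1 = 1.
Proof. by rewrite lfunE /=; apply/eqP; rewrite algid_eq1 sq_1. Qed.

Lemma inclM : {morph ι : a b / a * b}.
Proof. by move=> a b; rewrite !lfunE. Qed.

Lemma incl2K : cancel ι2 (tmap π π). Proof. exact: tmapK inclK inclK. Qed.
Lemma incl3K : cancel ι3 (tmap (tmap π π) π).
Proof. exact: tmapK incl2K inclK. Qed.
Lemma incl4K : cancel ι4 (tmap (tmap (tmap π π) π) π).
Proof. exact: tmapK incl3K inclK. Qed.
Lemma incl2M : {morph ι2 : a b / a * b}. Proof. exact: tmapM inclM inclM. Qed.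
Lemma incl3M : {morph ι3 : a b / a * b}. Proof. exact: tmapM incl2M inclM. Qed.
Lemma incl4M : {morph ι4 : a b / a * b}. Proof. exact: tmapM incl3M inclM. Qed.
Lemma incl21 : ι2 1 = 1. Proof. exact: tmap1 incl1 incl1. Qed.
Lemma incl31 : ι3 1 = 1. Proof. exact: tmap1 incl21 incl1. Qed.

Lemma incl_Delta a : ι2 (rs_Delta a) = Δ (ι a).
Proof.
have -> : rs_Delta a = tmap π π (Δ (vsval a)) by apply: lfunE.
rewrite inclE.
have /memv_imgP[x _ ->] := sq_Delta (subvsP a).
by rewrite incl2K.
Qed.

Lemma rs_epsE a : rs_eps a = ε (ι a).
Proof. by rewrite /rs_eps inclE lfunE. Qed.

Lemma incl_Phi : ι3 rs_Phi = Φ.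
Proof.
by rewrite /rs_Phi; have /memv_imgP[x _ ->] := sq_Phi A; rewrite incl3K.
Qed.

Lemma incl_S a : ι (rs_S a) = S (ι a).
Proof.
by rewrite /rs_S !inclE lfunE /= vsprojK // sq_S // subvsP.
Qed.

Lemma incl_alpha : ι rs_alpha = α.
Proof. by rewrite /rs_alpha inclE vsprojK // sq_alpha. Qed.

Lemma incl_beta : ι rs_beta = β.
Proof. by rewrite /rs_beta inclE vsprojK // sq_beta. Qed.

Lemma incl_Phi_unit :
  rs_Phi \is a GRing.unit /\ ι3 rs_Phi^-1 = Ψ.
Proof.
have [] := @unit_inj _ _ _ ι3 rs_Phi.
- exact: can_inj incl3K.
- exact: incl3M.
- exact: incl31.
- by rewrite incl_Phi qh_Phi_unit.
by rewrite incl_Phi.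
Qed.

Lemma rs_Delta1 : rs_Delta 1 = 1.
Proof.
by apply: (can_inj incl2K); rewrite incl_Delta incl1 qh_Delta1 incl21.
Qed.

Lemma rs_DeltaM : {morph rs_Delta : a b / a * b}.
Proof.
move=> a b; apply: (can_inj incl2K).
by rewrite incl2M !incl_Delta inclM qh_DeltaM.
Qed.

Lemma rs_eps1 : rs_eps 1 = 1.
Proof. by rewrite rs_epsE incl1 qh_eps1. Qed.

Lemma rs_epsM : {morph rs_eps : a b / a * b}.
Proof. by move=> a b; rewrite !rs_epsE inclM qh_epsM. Qed.

Lemma rs_counitl h : \sw_(a, b <- rs_Delta h) (rs_eps a *: b) = h.
Proof.
apply: (can_inj inclK); rewrite -[RHS]qh_counitl.
apply: sw_nat => [||a b]; [bilin | exact: incl_Delta |].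
by rewrite linearZ /= rs_epsE.
Qed.

Lemma rs_counitr h : \sw_(a, b <- rs_Delta h) (rs_eps b *: a) = h.
Proof.
apply: (can_inj inclK); rewrite -[RHS]qh_counitr.
apply: sw_nat => [||a b]; [bilin | exact: incl_Delta |].
by rewrite linearZ /= rs_epsE.
Qed.

Lemma rs_coassoc h :
    (\sw_(a, b <- rs_Delta h) (rs_Delta a ⊗ b)) * rs_Phi
    = rs_Phi * (\sw_(a, b <- rs_Delta h) \sw_(c, d <- rs_Delta b) (a ⊗ c ⊗ d)).
Proof.
apply: (can_inj incl3K); rewrite !incl3M incl_Phi.
rewrite (sw_nat (L := ι3) (F' := fun a b => Δ a ⊗ b) _ (incl_Delta h)).
- rewrite qh_coassoc; congr (_ * _); symmetry.
  apply: sw_nat => [||a b]; [bilin | exact: incl_Delta |].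
  apply: sw_nat => [||c d]; [bilin | exact: incl_Delta |].
  by rewrite /= !tmap_pure.
- bilin.
- by move=> a b; rewrite /= tmap_pure incl_Delta.
Qed.

Lemma rs_normal :
  \sw_(a, b, c <- rs_Phi) ((rs_eps b : k) *: (a ⊗ c)) = 1 :> tens B B.
Proof.
apply: (can_inj incl2K); apply: (etrans _ (esym incl21)).
rewrite -[RHS](qh_normal H).
apply: sw3_nat incl_Phi _ => [c|a b|a b c]; [bilin | lin |].
by rewrite linearZ /= tmap_pure rs_epsE.
Qed.

Lemma rs_cocycle :
  (\sw_(a, b, c <- rs_Phi) (rs_Delta a ⊗ b ⊗ c)) *
    (\sw_(a, b, c <- rs_Phi) \sw_(d, e <- rs_Delta c) (a ⊗ b ⊗ d ⊗ e))
    = (rs_Phi ⊗ 1) *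
      (\sw_(a, b, c <- rs_Phi) \sw_(d, e <- rs_Delta b) (a ⊗ d ⊗ e ⊗ c)) *
      (\sw_(a, b, c <- rs_Phi) (1 ⊗ a ⊗ b ⊗ c)).
Proof.
apply: (can_inj incl4K); rewrite !incl4M [ι4 (rs_Phi ⊗ 1)]tmap_pure.
rewrite incl_Phi incl1.
have -> : ι4 (\sw_(a, b, c <- rs_Phi) (rs_Delta a ⊗ b ⊗ c)) =
    \sw_(a, b, c <- Φ) (Δ a ⊗ b ⊗ c).
  apply: sw3_nat incl_Phi _ => [c|a b|a b c]; [bilin | lin |].
  by rewrite /= !tmap_pure incl_Delta.
have -> : ι4 (\sw_(a, b, c <- rs_Phi) \sw_(d, e <- rs_Delta c) (a ⊗ b ⊗ d ⊗ e))
    = \sw_(a, b, c <- Φ) \sw_(d, e <- Δ c) (a ⊗ b ⊗ d ⊗ e).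
  apply: sw3_nat incl_Phi _ => [c|a b|a b c]; [bilin | lin |].
  apply: sw_nat (incl_Delta _) _ => [|d e]; first bilin.
  by rewrite /= !tmap_pure.
have -> : ι4 (\sw_(a, b, c <- rs_Phi) \sw_(d, e <- rs_Delta b) (a ⊗ d ⊗ e ⊗ c))
    = \sw_(a, b, c <- Φ) \sw_(d, e <- Δ b) (a ⊗ d ⊗ e ⊗ c).
  apply: sw3_nat incl_Phi _ => [c|a b|a b c]; [bilin | lin |].
  apply: sw_nat (incl_Delta _) _ => [|d e]; first bilin.
  by rewrite /= !tmap_pure.
have -> : ι4 (\sw_(a, b, c <- rs_Phi) (1 ⊗ a ⊗ b ⊗ c)) =
    \sw_(a, b, c <- Φ) (1 ⊗ a ⊗ b ⊗ c).
  apply: sw3_nat incl_Phi _ => [c|a b|a b c]; [bilin | lin |].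
  by rewrite /= !tmap_pure incl1.
exact: qh_cocycle.
Qed.

Lemma rs_S1 : rs_S 1 = 1.
Proof. by apply: (can_inj inclK); rewrite incl_S incl1 qh_S1. Qed.

Lemma rs_SM a b : rs_S (a * b) = rs_S b * rs_S a.
Proof. by apply: (can_inj inclK); rewrite inclM !incl_S inclM qh_SM. Qed.

Lemma rs_S_bij : bijective rs_S.
Proof.
have kS : lker rs_S == 0%VS.
  apply/lker0P=> a b /(congr1 ι); rewrite !incl_S => /(bij_inj (qh_S_bij H)).
  exact: (can_inj inclK).
by exists (rs_S^-1)%VF => a; [rewrite lker0_lfunK | rewrite lker0_lfunVK].
Qed.

Lemma rs_antipodel h :
  \sw_(a, b <- rs_Delta h) (rs_S a * rs_alpha * b) = rs_eps h *: rs_alpha.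
Proof.
apply: (can_inj inclK); rewrite linearZ /= incl_alpha rs_epsE -qh_antipodel.
apply: sw_nat (incl_Delta _) _ => [|a b]; first bilin.
by rewrite /= !inclM incl_S incl_alpha.
Qed.

Lemma rs_antipoder h :
  \sw_(a, b <- rs_Delta h) (a * rs_beta * rs_S b) = rs_eps h *: rs_beta.
Proof.
apply: (can_inj inclK); rewrite linearZ /= incl_beta rs_epsE -qh_antipoder.
apply: sw_nat (incl_Delta _) _ => [|a b]; first bilin.
by rewrite /= !inclM incl_S incl_beta.
Qed.

Lemma rs_zigzag :
  \sw_(a, b, c <- rs_Phi) (rs_S a * rs_alpha * b * rs_beta * rs_S c) = 1.
Proof.
apply: (can_inj inclK); rewrite [RHS]incl1 -[RHS](qh_zigzag H).
apply: sw3_nat incl_Phi _ => [c|a b|a b c]; [bilin | lin |].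
by rewrite /= !inclM !incl_S incl_alpha incl_beta.
Qed.

Lemma rs_zigzag' :
  \sw_(a, b, c <- rs_Phi^-1) (a * rs_beta * rs_S b * rs_alpha * c) = 1.
Proof.
apply: (can_inj inclK); rewrite [RHS]incl1 -[RHS](qh_zigzag' H).
apply: sw3_nat incl_Phi_unit.2 _ => [c|a b|a b c]; [bilin | lin |].
by rewrite /= !inclM !incl_S incl_alpha incl_beta.
Qed.

Definition rs_quasiHopf : quasiHopf k :=
  QuasiHopf rs_Delta1 rs_DeltaM rs_eps1 rs_epsM rs_counitl rs_counitr
    incl_Phi_unit.1 rs_coassoc rs_normal rs_cocycle rs_S1 rs_SM rs_S_bij
    rs_antipodel rs_antipoder rs_zigzag rs_zigzag'.

End Restriction.

Section LinearHom.
Variable k : fieldType.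
Implicit Types (W : lmodType k) (U V T : vectType k).

Lemma linfunE U V (f : U -> V) : linear f -> linfun f =1 f.
Proof.
move=> lf; pose fL : {linear U -> V} :=
  HB.pack f (GRing.isLinear.Build k _ _ _ f lf).
exact: (lfunE fL).
Qed.

Lemma lin_comp W U V T (F : W -> 'Hom(V, T)) (g : 'Hom(U, V)) :
  linear F -> linear (fun x => (F x \o g)%VF).
Proof. by move=> lF c x y; rewrite lF comp_lfunDl comp_lfunZl. Qed.

Lemma lin_comp' W U V T (f : 'Hom(V, T)) (G : W -> 'Hom(U, V)) :
  linear G -> linear (fun x => (f \o G x)%VF).
Proof. by move=> lG c x y; rewrite lG comp_lfunDr comp_lfunZr. Qed.

Lemma lin_lapp W U V (F : W -> 'Hom(U, V)) u :
  linear F -> linear (fun x => F x u).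
Proof. by move=> lF c x y; rewrite lF add_lfunE scale_lfunE. Qed.

Lemma lin_linfun W U V (F : W -> U -> V) :
  (forall x, linear (F x)) -> (forall u, linear (F^~ u)) ->
  linear (fun x => linfun (F x)).
Proof.
move=> lF lF' c x y; apply/lfunP=> u.
by rewrite add_lfunE scale_lfunE !linfunE // lF'.
Qed.

Lemma lin_tmapl W U V (U' V' : vectType k) (F : W -> 'Hom(U, U'))
    (g : 'Hom(V, V')) : linear F -> linear (fun x => tmap (F x) g).
Proof.
move=> lF; apply: lin_linfun => [x|t]; first by lin.
by apply: lin_sw' => u v; apply: lin_tpurel; apply: lin_lapp.
Qed.

Lemma lin_tmapr W U V (U' V' : vectType k) (f : 'Hom(U, U'))
    (G : W -> 'Hom(V, V')) : linear G -> linear (fun x => tmap f (G x)).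
Proof.
move=> lG; apply: lin_linfun => [x|t]; first by lin.
by apply: lin_sw' => u v; apply: lin_tpurer; apply: lin_lapp.
Qed.

End LinearHom.

Ltac lin ::= first
  [ exact: lin_id
  | apply: lin_tpurel; lin | apply: lin_tpurer; lin
  | apply: lin_mull; lin | apply: lin_mulr; lin
  | apply: lin_scalel; lin | apply: lin_scaler; lin
  | apply: lin_comp; lin | apply: lin_comp'; lin
  | apply: lin_tmapl; lin | apply: lin_tmapr; lin
  | apply: lin_linfun => ?; lin
  | apply: lin_sw; lin
  | apply: lin_sw' => ? ?; lin
  | apply: lin_app; lin
  | apply: lin_lapp; lin ].

Record module (k : fieldType) (A : falgType k) := Module {
  mod_sort :> vectType k;
  mod_act : 'Hom(A, 'End(mod_sort));
  mod_act1 : mod_act 1 = \1%VF;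
  mod_actM : forall a b, mod_act (a * b) = (mod_act a \o mod_act b)%VF
}.

Notation "a ▷ m" := (mod_act _ a m) (at level 40, m at next level)
  : ring_scope.

Section Modules.
Variables (k : fieldType) (A : falgType k).
Implicit Types M N P : module A.

Definition is_hom M N (f : 'Hom(M, N)) := forall a m, f (a ▷ m) = a ▷ f m.

Definition regular_act : 'Hom(A, 'End(A)) := linfun (@amull k A).

Lemma regular_actE a b : regular_act a b = a * b.
Proof. by rewrite [regular_act a]lfunE [LHS]lfunE. Qed.

Fact regular_act1 : regular_act 1 = \1%VF.
Proof. by apply/lfunP=> x; rewrite id_lfunE regular_actE mul1r. Qed.
Fact regular_actM a b :
  regular_act (a * b) = (regular_act a \o regular_act b)%VF.
Proof. by apply/lfunP=> x; rewrite comp_lfunE !regular_actE mulrA. Qed.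

(* A acting on itself by left multiplication *)
Definition regular_mod : module A := Module regular_act1 regular_actM.

Definition projective P :=
  forall (M N : module A) (e : 'Hom(M, N)) (f : 'Hom(P, N)),
    is_hom e -> is_hom f -> (forall n, exists m, e m = n) ->
    exists2 g : 'Hom(P, M), is_hom g & (e \o g)%VF = f.

End Modules.

Section ModuleCategory.
Variables (k : fieldType) (H : quasiHopf k).
Implicit Types X Y Z V : module H.

Definition unit_act : 'Hom(H, 'End(k^o)) :=
  linfun (fun h : H => (ε h : k) *: \1%VF).

Fact unit_act1 : unit_act 1 = \1%VF.
Proof. by rewrite linfunE; [rewrite qh_eps1 scale1r | lin]. Qed.
Fact unit_actM a b : unit_act (a * b) = (unit_act a \o unit_act b)%VF.
Proof.
rewrite !linfunE; try lin.
by rewrite qh_epsM -comp_lfunZl -comp_lfunZr comp_lfun1l scalerA.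
Qed.
Definition unit_mod : module H := Module unit_act1 unit_actM.

Definition tens_rep X Y (x : tens H H) : 'End(tens X Y) :=
  \sw_(a, b <- x) tmap (mod_act X a) (mod_act Y b).

Lemma tens_repM X Y x y :
  tens_rep X Y (x * y) = (tens_rep X Y x \o tens_rep X Y y)%VF.
Proof.
move: x; apply: tens_lin_ext; try by rewrite /tens_rep; lin.
move=> a b; move: y; apply: tens_lin_ext; try by rewrite /tens_rep; lin.
move=> c d; rewrite tens_mulE /tens_rep !tlift_pure; try by bilin.
apply/lfunP; apply: tens_lin_ext => [e u v|e u v|u v]; rewrite ?linearP //.
by rewrite comp_lfunE !tmap_pure !mod_actM !comp_lfunE.
Qed.

Definition tens_act X Y : 'Hom(H, 'End(tens X Y)) :=
  linfun (fun h => tens_rep X Y (Δ h)).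

Lemma tens_actE X Y h : tens_act X Y h = tens_rep X Y (Δ h).
Proof. by rewrite linfunE //; rewrite /tens_rep; lin. Qed.

Fact tens_act1 X Y : tens_act X Y 1 = \1%VF.
Proof.
rewrite tens_actE qh_Delta1 /tens_rep tlift_pure; last by bilin.
rewrite !mod_act1; apply/lfunP.
apply: tens_lin_ext => [e u v|e u v|u v]; rewrite ?linearP //.
by rewrite tmap_pure !id_lfunE.
Qed.
Fact tens_actM X Y a b :
  tens_act X Y (a * b) = (tens_act X Y a \o tens_act X Y b)%VF.
Proof. by rewrite !tens_actE qh_DeltaM tens_repM. Qed.
Definition tens_mod X Y : module H := Module (tens_act1 X Y) (@tens_actM X Y).

(* (h f)(v) = f(S(h) v) *)
Definition dual_act V : 'Hom(H, 'End('Hom(V, k^o))) :=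
  linfun (fun h => linfun (fun f : 'Hom(V, k^o) => (f \o mod_act V (S h))%VF)).

Lemma dual_actE V h f : dual_act V h f = (f \o mod_act V (S h))%VF.
Proof. by rewrite /dual_act linfunE; [rewrite linfunE //; lin | lin]. Qed.

Fact dual_act1 V : dual_act V 1 = \1%VF.
Proof.
by apply/lfunP=> f; rewrite dual_actE qh_S1 mod_act1 comp_lfun1r id_lfunE.
Qed.
Fact dual_actM V a b : dual_act V (a * b) = (dual_act V a \o dual_act V b)%VF.
Proof.
apply/lfunP=> f; rewrite comp_lfunE !dual_actE qh_SM mod_actM.
by rewrite comp_lfunA.
Qed.
Definition dual_mod V : module H := Module (dual_act1 V) (@dual_actM V).

Local Notation "𝟙" := unit_mod.
Local Notation "X ⊠ Y" := (tens_mod X Y) (at level 40, left associativity).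
Local Notation "V ^∨" := (dual_mod V) (at level 2, format "V ^∨").

Definition assoc X Y Z : 'Hom(X ⊠ (Y ⊠ Z), (X ⊠ Y) ⊠ Z) :=
  linfun (fun t : X ⊠ (Y ⊠ Z) => \sw_(x, s <- t) \sw_(y, z <- s)
    \sw_(a, b, c <- Φ) ((a ▷ x) ⊗ (b ▷ y) ⊗ (c ▷ z))).

Definition assocV X Y Z : 'Hom((X ⊠ Y) ⊠ Z, X ⊠ (Y ⊠ Z)) :=
  linfun (fun t : (X ⊠ Y) ⊠ Z => \sw_(x, y, z <- t)
    \sw_(a, b, c <- Ψ) ((a ▷ x) ⊗ ((b ▷ y) ⊗ (c ▷ z)))).

Definition lunit X : 'Hom(𝟙 ⊠ X, X) :=
  linfun (fun t : 𝟙 ⊠ X => \sw_(c, x <- t) ((c : k^o) *: x)).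
Definition lunitV X : 'Hom(X, 𝟙 ⊠ X) :=
  linfun (fun x => (1 : k^o) ⊗ x).
Definition runit X : 'Hom(X ⊠ 𝟙, X) :=
  linfun (fun t : X ⊠ 𝟙 => \sw_(x, c <- t) ((c : k^o) *: x)).
Definition runitV X : 'Hom(X, X ⊠ 𝟙) :=
  linfun (fun x => x ⊗ (1 : k^o)).

Definition dual_basis V (i : 'I_(\dim {:V})) : 'Hom(V, k^o) :=
  linfun (coord (vbasis {:V}) i : V -> k^o).

Definition ev V : 'Hom(V^∨ ⊠ V, 𝟙) :=
  linfun (fun t : V^∨ ⊠ V => \sw_(f, v <- t) (f : 'Hom(V, k^o)) (α ▷ v)).
Definition coev V : 'Hom(𝟙, V ⊠ V^∨) :=
  linfun (fun c : k^o => (c : k) *: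
    \sum_(i < \dim {:V}) (β ▷ (vbasis {:V})`_i) ⊗ dual_basis i).

(* the other duality maps, for the pivot g *)
Definition evt (g : H) V : 'Hom(V ⊠ V^∨, 𝟙) :=
  linfun (fun t : V ⊠ V^∨ => \sw_(v, f <- t) (f : 'Hom(V, k^o)) ((S α * g) ▷ v)).
Definition coevt (g : H) V : 'Hom(𝟙, V^∨ ⊠ V) :=
  linfun (fun c : k^o => (c : k) *:
    \sum_(i < \dim {:V}) dual_basis i ⊗ (Sinv (g * β) ▷ (vbasis {:V})`_i)).

Definition right_ptr (g : H) X V (f : 'End(X ⊠ V)) : 'End(X) :=
  (runit X \o tmap \1 (evt g V) \o assocV X V V^∨ \o tmap f \1
   \o assoc X V V^∨ \o tmap \1 (coev V) \o runitV X)%VF.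

Definition left_ptr (g : H) V X (f : 'End(V ⊠ X)) : 'End(X) :=
  (lunit X \o tmap (ev V) \1 \o assoc V^∨ V X \o tmap \1 f
   \o assocV V^∨ V X \o tmap (coevt g V) \1 \o lunitV X)%VF.

(* Full subcategories of modules are encoded by predicates on objects. *)
Implicit Type I : module H -> Prop.

Definition retract_closed I :=
  forall X Y (i : 'Hom(Y, X)) (p : 'Hom(X, Y)),
    is_hom i -> is_hom p -> (p \o i = \1)%VF -> I X -> I Y.

Definition right_tensor_ideal I :=
  retract_closed I /\ forall X V, I X -> I (X ⊠ V).
Definition left_tensor_ideal I :=
  retract_closed I /\ forall X V, I X -> I (V ⊠ X).

(* A family of linear forms t_X : End_H(X) -> k, X in I, is encoded by functions
   [t X] on all linear endomorphisms, of which only the values on module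
   endomorphisms of objects of I matter. *)
Definition cyclic_trace I (t : forall X : module H, 'End(X) -> k) :=
  (forall X, I X -> forall c (f f' : 'End(X)), is_hom f -> is_hom f' ->
     t X (c *: f + f') = c * t X f + t X f') /\
  (forall X Y, I X -> I Y -> forall (f : 'Hom(X, Y)) (g : 'Hom(Y, X)),
     is_hom f -> is_hom g -> t X (g \o f)%VF = t Y (f \o g)%VF).

Record right_modified_trace (g : H) I (t : forall X : module H, 'End(X) -> k)
    : Prop := RightModifiedTrace {
  rmt_ideal : right_tensor_ideal I;
  rmt_cyclic : cyclic_trace I t;
  rmt_ptr : forall X V, I X -> forall f : 'End(X ⊠ V), is_hom f ->
    t (X ⊠ V) f = t X (right_ptr g f)
}.

Record left_modified_trace (g : H) I (t : forall X : module H, 'End(X) -> k)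
    : Prop := LeftModifiedTrace {
  lmt_ideal : left_tensor_ideal I;
  lmt_cyclic : cyclic_trace I t;
  lmt_ptr : forall V X, I X -> forall f : 'End(V ⊠ X), is_hom f ->
    t (V ⊠ X) f = t X (left_ptr g f)
}.

(* The trace on projective modules corresponding to a symmetrised
   cointegral l. *)
Definition corresponds (l : 'Hom(H, k^o)) (t : forall X : module H, 'End(X) -> k) :=
  forall (P : module H) (p : 'Hom(regular_mod H, P)) (i : 'Hom(P, regular_mod H)),
    is_hom p -> is_hom i -> (p \o i = \1)%VF ->
    forall f : 'End(P), is_hom f -> t P f = l ((i \o f \o p)%VF 1).

End ModuleCategory.

Section Res.
Variables (k : fieldType) (H : quasiHopf k) (A : subQuasiHopf H).

Definition res_act (M : module H) : 'Hom(rs_quasiHopf A, 'End(M)) :=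
  (mod_act M \o incl A)%VF.

Fact res_act1 M : res_act M 1 = \1%VF.
Proof. by rewrite comp_lfunE incl1 mod_act1. Qed.
Fact res_actM M a b : res_act M (a * b) = (res_act M a \o res_act M b)%VF.
Proof. by rewrite !comp_lfunE inclM mod_actM. Qed.

Definition res_mod (M : module H) : module (rs_quasiHopf A) :=
  Module (res_act1 M) (@res_actM M).

(* an element of H lying in A, as an element of A *)
Definition to_sub (h : H) : rs_quasiHopf A := retr A h.

(* the objects of I(A) *)
Definition projective_over (M : module H) := projective (res_mod M).

Definition res_trace (t : forall X : module (rs_quasiHopf A), 'End(X) -> k)
  (M : module H) (f : 'End(M)) : k := t (res_mod M) f.

(* p_i : Res M -> A and j_i : A -> Res M exhibiting Res M as a finite direct sum
   of direct summands of A *)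
Definition summand_decomposition (M : module H) (n : nat)
    (p : 'I_n -> 'Hom(res_mod M, regular_mod (rs_quasiHopf A)))
    (j : 'I_n -> 'Hom(regular_mod (rs_quasiHopf A), res_mod M)) :=
  [/\ forall i, is_hom (p i), forall i, is_hom (j i),
      \sum_i (j i \o p i)%VF = \1%VF
    & forall l m, (p l \o j m)%VF = (p l \o j l)%VF *+ (l == m)].

(* The values of Res^* t on End_H(M), M in I(A), in terms of the symmetrised
   cointegral l: decompositions exist, and any of them computes the trace. *)
Definition res_trace_formula (l : 'Hom(rs_quasiHopf A, k^o))
    (t : forall X : module (rs_quasiHopf A), 'End(X) -> k) :=
  forall M : module H, projective_over M ->
    (exists n (p : 'I_n -> 'Hom(_, _)) (j : 'I_n -> 'Hom(_, _)),
       @summand_decomposition M n p j) /\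
    (forall n (p : 'I_n -> 'Hom(_, _)) (j : 'I_n -> 'Hom(_, _)),
       @summand_decomposition M n p j ->
       forall f : 'End(M), is_hom f ->
         res_trace t f = \sum_i l ((p i \o f \o j i)%VF 1)).

End Res.

(* Main.v *)
(** Since the structure elements of H and the pivot lie in A, Res keeps the
    underlying spaces of tensor products and duals, the associators and the
    duality maps.  So partial traces commute with Res, and the axioms of a
    modified trace pull back.

    The explicit formula follows from cyclicity: f is the sum of the
    (f o j_i) o p_i, and the trace of (f o j_i) o p_i on Res M is the one of
    p_i o f o j_i on A.  Decompositions exist by a Krull-Schmidt argument carried
    out with idempotents of End_A(M): when e is primitive, e End_A(M) e is local
    by Fitting's lemma, and since e is a sum of maps factoring through A, one of
    these is invertible in this corner, so that e M is a direct summand of A. *)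

From Stdlib Require Import Classical.
Require Import Defs.
From mathcomp Require Import all_boot all_order all_algebra all_field.

Set Implicit Arguments.
Unset Strict Implicit.
Unset Printing Implicit Defensive.


Import GRing.Theory.
Local Open Scope ring_scope.

(** * Restriction to [A] of tensor products, duality maps and associators *)

Section RestrictedOperations.
Variables (k : fieldType) (H : quasiHopf k) (A : subQuasiHopf H).
Local Notation B := (rs_quasiHopf A).
Local Notation R := (@res_mod k H A).
Implicit Types X V : module H.

(** The matrix of [linfun f] consists of the values of [f] on a basis. This lets the structure maps,
    all built with [linfun], be compared pointwise. *)
Lemma eq_linfun (U V : vectType k) (f f' : U -> V) :
  f =1 f' -> linfun f = linfun f'.
Proof.
move=> ef; rewrite !unlock; congr Hom; apply/matrixP=> i j.
by rewrite !mxE /= ef.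
Qed.

Lemma res_actE X a (x : X) : (a : B) ▷ (x : R X) = incl A a ▷ x.
Proof. by rewrite [LHS]/= comp_lfunE. Qed.

Lemma dual_resE V a (f : 'Hom(V, k^o)) :
  (a : B) ▷ (f : dual_mod (R V)) = incl A a ▷ (f : dual_mod V).
Proof. by rewrite [LHS]dual_actE [RHS]dual_actE /= comp_lfunE incl_S. Qed.

Lemma sw_incl (W : lmodType k) (F : H -> H -> W) x :
  bilin F -> \sw_(a, b <- x) F (incl A a) (incl A b)
    = \sw_(a, b <- tmap (incl A) (incl A) x) F a b.
Proof. by move=> bF; rewrite tlift_tmap. Qed.

Lemma sw3_incl (W : lmodType k) (F : H -> H -> H -> W) x :
  (forall c, bilin (fun a b => F a b c)) -> (forall a b, linear (F a b)) ->
  \sw_(a, b, c <- x) F (incl A a) (incl A b) (incl A c)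
    = \sw_(a, b, c <- tmap (tmap (incl A) (incl A)) (incl A) x) F a b c.
Proof.
move=> bF lF.
exact: (sw3_nat (L := idfun) (f := incl A) (g := incl A) (h := incl A)
  (F := fun a b c => F (incl A a) (incl A b) (incl A c)) bF lF (erefl _)
  (fun _ _ _ => erefl _)).
Qed.

Lemma tens_act_res X V (a : B) :
  tens_act (R X) (R V) a = tens_act X V (incl A a) :> 'End(tens X V).
Proof.
transitivity (tens_rep (R X) (R V) (qh_Delta B a)).
  exact: (tens_actE (R X) (R V) a).
rewrite tens_actE -incl_Delta /tens_rep.
rewrite -(sw_incl (F := fun b c => tmap (mod_act X b) (mod_act V c))).
  by apply: eq_tlift => b c; rewrite /= !comp_lfunE.
by bilin.
Qed.

Lemma tens_res_actE X V a (x : tens X V) :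
  (a : B) ▷ (x : tens_mod (R X) (R V)) = (a : B) ▷ (x : R (tens_mod X V)).
Proof. by rewrite res_actE [mod_act _]/= tens_act_res. Qed.

Lemma res_hom X V (f : 'Hom(X, V)) :
  is_hom f -> is_hom (f : 'Hom(R X, R V)).
Proof. by move=> hf a x; rewrite !res_actE hf. Qed.

(** Both modules have the same underlying space by conversion, but their actions are only provably
    equal. The identity map therefore serves as an explicit isomorphism between two distinct
    objects. *)
Lemma tens_res_hom X V :
  is_hom (\1%VF : 'Hom(tens_mod (R X) (R V), R (tens_mod X V))).
Proof. by move=> a x; rewrite !id_lfunE tens_res_actE. Qed.

Lemma res_tens_hom X V :
  is_hom (\1%VF : 'Hom(R (tens_mod X V), tens_mod (R X) (R V))).
Proof. by move=> a x; rewrite !id_lfunE tens_res_actE. Qed.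

Lemma ev_res V : ev (R V) = ev V :> 'Hom(tens 'Hom(V, k^o) V, k^o).
Proof.
apply: eq_linfun => t; apply: eq_tlift => f v; congr (fun_of_lfun _ _).
by rewrite res_actE incl_alpha.
Qed.

Lemma coev_res V : coev (R V) = coev V :> 'Hom(k^o, tens V 'Hom(V, k^o)).
Proof.
apply: eq_linfun => c; congr (_ *: _); apply: eq_bigr => i _; congr (_ ⊗ _).
by rewrite res_actE incl_beta.
Qed.

(** [coevt] involves the inverse antipode, which for [A] is formed inside [A]. The two inverses
    agree since [incl A] intertwines the antipodes and both are bijective. *)
Lemma Sinv_res b : incl A ((qh_S B)^-1%VF b) = (qh_S H)^-1%VF (incl A b).
Proof.
have kS (C : quasiHopf k) : lker (qh_S C) == 0%VS.
  by apply/lker0P; apply: bij_inj; apply: qh_S_bij.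
apply: (bij_inj (qh_S_bij H)).
rewrite (lker0_lfunVK (kS H)) -incl_S; congr (incl A _).
exact: (lker0_lfunVK (kS B)).
Qed.

Lemma assoc_right_res X V :
  assoc (R X) (R V) (dual_mod (R V)) = assoc X V (dual_mod V)
    :> 'Hom(tens X (tens V 'Hom(V, k^o)), tens (tens X V) 'Hom(V, k^o)).
Proof.
apply: eq_linfun => t; apply: eq_tlift => x s; apply: eq_tlift => v f.
(* Writing [Φ] as the image of the coassociator of [A] lets [sw3_incl] turn the sum over [Φ] into a
   sum over [A]. *)
rewrite -(incl_Phi A).
rewrite -(sw3_incl (F := fun a b c =>
   (a ▷ x) ⊗ (b ▷ v) ⊗ (c ▷ (f : dual_mod V))));
  [|by move=> *; bilin|by move=> *; lin].
apply: eq_tlift => u c; apply: eq_tlift => a b.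
by rewrite !res_actE dual_resE.
Qed.

Lemma assocV_right_res X V :
  assocV (R X) (R V) (dual_mod (R V)) = assocV X V (dual_mod V)
    :> 'Hom(tens (tens X V) 'Hom(V, k^o), tens X (tens V 'Hom(V, k^o))).
Proof.
apply: eq_linfun => t; apply: eq_tlift => s f; apply: eq_tlift => x v.
rewrite -(incl_Phi_unit A).2.
rewrite -(sw3_incl (F := fun a b c =>
   (a ▷ x) ⊗ ((b ▷ v) ⊗ (c ▷ (f : dual_mod V)))));
  [|by move=> *; bilin|by move=> *; lin].
apply: eq_tlift => u c; apply: eq_tlift => a b.
by rewrite !res_actE dual_resE.
Qed.

Lemma assoc_left_res X V :
  assoc (dual_mod (R V)) (R V) (R X) = assoc (dual_mod V) V X
    :> 'Hom(tens 'Hom(V, k^o) (tens V X), tens (tens 'Hom(V, k^o) V) X).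
Proof.
apply: eq_linfun => t; apply: eq_tlift => f s; apply: eq_tlift => v x.
rewrite -(incl_Phi A).
rewrite -(sw3_incl (F := fun a b c =>
   (a ▷ (f : dual_mod V)) ⊗ (b ▷ v) ⊗ (c ▷ x)));
  [|by move=> *; bilin|by move=> *; lin].
apply: eq_tlift => u c; apply: eq_tlift => a b.
by rewrite !res_actE dual_resE.
Qed.

Lemma assocV_left_res X V :
  assocV (dual_mod (R V)) (R V) (R X) = assocV (dual_mod V) V X
    :> 'Hom(tens (tens 'Hom(V, k^o) V) X, tens 'Hom(V, k^o) (tens V X)).
Proof.
apply: eq_linfun => t; apply: eq_tlift => s x; apply: eq_tlift => f v.
rewrite -(incl_Phi_unit A).2.
rewrite -(sw3_incl (F := fun a b c =>
   (a ▷ (f : dual_mod V)) ⊗ ((b ▷ v) ⊗ (c ▷ x))));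
  [|by move=> *; bilin|by move=> *; lin].
apply: eq_tlift => u c; apply: eq_tlift => a b.
by rewrite !res_actE dual_resE.
Qed.

Variable g : H.
Hypothesis gA : g \in sq_alg A.

Lemma evt_res V :
  evt (to_sub A g) (R V) = evt g V :> 'Hom(tens V 'Hom(V, k^o), k^o).
Proof.
apply: eq_linfun => t; apply: eq_tlift => v f; congr (fun_of_lfun _ _).
rewrite res_actE; congr (fun_of_lfun (mod_act V _) v).
by rewrite inclM incl_S incl_alpha retrK.
Qed.

Lemma coevt_res V :
  coevt (to_sub A g) (R V) = coevt g V :> 'Hom(k^o, tens 'Hom(V, k^o) V).
Proof.
apply: eq_linfun => c; congr (_ *: _); apply: eq_bigr => i _; congr (_ ⊗ _).
rewrite res_actE Sinv_res; congr (fun_of_lfun (mod_act V (_ _)) _).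
by rewrite inclM incl_beta retrK.
Qed.

Lemma right_ptr_res X V (f : 'End(tens X V)) :
  right_ptr (to_sub A g) (f : 'End(tens_mod (R X) (R V))) = right_ptr g f
    :> 'End(X).
Proof.
by rewrite /right_ptr evt_res coev_res assoc_right_res assocV_right_res.
Qed.

Lemma left_ptr_res X V (f : 'End(tens V X)) :
  left_ptr (to_sub A g) (f : 'End(tens_mod (R V) (R X))) = left_ptr g f
    :> 'End(X).
Proof.
by rewrite /left_ptr ev_res coevt_res assoc_left_res assocV_left_res.
Qed.

End RestrictedOperations.

(** * Module morphisms, free modules and projective modules *)

Section ModuleTheory.
Variables (k : fieldType) (A : falgType k).
Implicit Types M N P : module A.

Lemma comp_hom M N P (f : 'Hom(N, P)) (g : 'Hom(M, N)) :
  is_hom f -> is_hom g -> is_hom (f \o g)%VF.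
Proof. by move=> hf hg a m; rewrite !comp_lfunE hg hf. Qed.

Lemma id_hom M : is_hom (\1%VF : 'End(M)).
Proof. by move=> a m; rewrite !id_lfunE. Qed.

Lemma add_hom M N (f g : 'Hom(M, N)) : is_hom f -> is_hom g -> is_hom (f + g).
Proof. by move=> hf hg a m; rewrite !add_lfunE hf hg linearD. Qed.

Lemma zero_hom M N : is_hom (0 : 'Hom(M, N)).
Proof. by move=> a m; rewrite !zero_lfunE linear0. Qed.

Lemma opp_hom M N (f : 'Hom(M, N)) : is_hom f -> is_hom (- f).
Proof. by move=> hf a m; rewrite !opp_lfunE hf linearN. Qed.

Lemma inv_hom M (f : 'End(M)) : lker f == 0%VS -> is_hom f -> is_hom (f^-1)%VF.
Proof.
move=> kf hf a m; have /lker0P fI := kf.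
by apply: fI; rewrite hf !lker0_lfunVK.
Qed.

Definition act_on M (m : M) : 'Hom(A, M) := linfun (fun a => a ▷ m).

Lemma act_onE M (m : M) a : act_on m a = a ▷ m.
Proof. by rewrite /act_on linfunE //; lin. Qed.

Lemma act_on_hom M (m : M) : is_hom (act_on m : 'Hom(regular_mod A, M)).
Proof.
by move=> a b; rewrite !act_onE [a ▷ b]regular_actE mod_actM comp_lfunE.
Qed.

(** A morphism out of the regular module is determined by its value at [1], so any preimage of [f 1]
    defines a lift. *)
Lemma regular_projective : projective (regular_mod A).
Proof.
move=> M N e f he hf esurj; have [m em] := esurj (f 1).
exists (act_on m); first exact: act_on_hom.
apply/lfunP=> a; rewrite comp_lfunE act_onE he em -hf.
by congr (f _); rewrite [LHS]regular_actE mulr1.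
Qed.

Section Free.
Variable V : vectType k.

(** The action on the free module generated by [V]; taken on the space underlying a module [P], this
    free module covers [P]. *)
Definition free_act : 'Hom(A, 'End(tens A V)) :=
  linfun (fun a => tmap (amull a) \1%VF).

Lemma free_actE a : free_act a = tmap (amull a) \1%VF.
Proof. by rewrite /free_act linfunE //; lin. Qed.

Fact free_act1 : free_act 1 = \1%VF.
Proof.
rewrite free_actE; apply/lfunP.
apply: tens_lin_ext => [e u v|e u v|u v]; rewrite ?linearP //.
by rewrite tmap_pure !id_lfunE lfunE /= mul1r.
Qed.

Fact free_actM a b : free_act (a * b) = (free_act a \o free_act b)%VF.
Proof.
rewrite !free_actE; apply/lfunP.
apply: tens_lin_ext => [e u v|e u v|u v]; rewrite ?linearP //.
by rewrite comp_lfunE !tmap_pure !id_lfunE !lfunE /= mulrA.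
Qed.

Definition free_mod : module A := Module free_act1 free_actM.

Lemma free_mod_act a b v :
  (a : A) ▷ ((b : A) ⊗ v : free_mod) = (a * b) ⊗ v :> tens A V.
Proof. by rewrite [mod_act _]/= free_actE tmap_pure id_lfunE lfunE. Qed.

End Free.

(** Dual basis lemma: [p i] is a section of the action map from the free module on [P], followed by
    the [i]-th coordinate, and [j i] sends [1] to the [i]-th basis vector. *)
Lemma projective_sum_id P : projective P ->
  exists (n : nat) (p : 'I_n -> 'Hom(P, regular_mod A))
         (j : 'I_n -> 'Hom(regular_mod A, P)),
    [/\ forall i, is_hom (p i), forall i, is_hom (j i)
      & \sum_i (j i \o p i)%VF = \1%VF].
Proof.
move=> projP.
pose e : 'Hom(free_mod P, P) := 
  linfun (fun t : tens A P => \sw_(a, m <- t) (a ▷ m)).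
have eE t : e t = \sw_(a, m <- t) (a ▷ m) by rewrite linfunE //; lin.
have e_pure a m : e (a ⊗ m) = a ▷ m.
  by rewrite eE (tlift_pure (F := fun a m => a ▷ m)) //; bilin.
have he : is_hom e.
  move=> a; apply: tens_lin_ext => [c u v|c u v|b m]; rewrite ?linearP //.
  by rewrite free_mod_act !e_pure mod_actM comp_lfunE.
have [|s hs es] := projP _ _ e \1%VF he (@id_hom P).
  by move=> m; exists ((1 : A) ⊗ m); rewrite e_pure mod_act1 id_lfunE.
pose c i : 'Hom(free_mod P, regular_mod A) :=
  linfun (fun t : tens A P => \sw_(a, m <- t) (coord (vbasis {:P}) i m *: a)).
have cE i t : c i t = \sw_(a, m <- t) (coord (vbasis {:P}) i m *: a).
  by rewrite linfunE //; lin.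
have c_pure i a m : c i (a ⊗ m) = coord (vbasis {:P}) i m *: a.
  rewrite cE (tlift_pure (F := fun a m => coord (vbasis {:P}) i m *: a)) //.
  split=> x; first by lin.
  by move=> d u v; rewrite linearP scalerDl scalerA.
have hc i : is_hom (c i).
  move=> a; apply: tens_lin_ext => [d u v|d u v|b m]; rewrite ?linearP //.
  by rewrite free_mod_act !c_pure [RHS]regular_actE scalerAr.
exists (\dim {:P}), (fun i => (c i \o s)%VF), (fun i => act_on (vbasis {:P})`_i).
split=> [i|i|]; [exact: comp_hom | exact: act_on_hom |].
rewrite -es; apply/lfunP=> x; rewrite sum_lfunE comp_lfunE.
under eq_bigr do rewrite !comp_lfunE act_onE.
(* The identity holds on the whole free module, so [s x] is generalised and pure tensors suffice. *)
move: (s x); apply: tens_lin_ext => [d u v|d u v|a m].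
- rewrite scaler_sumr -big_split; apply: eq_bigr => i _.
  by rewrite !linearP add_lfunE scale_lfunE.
- by rewrite linearP.
rewrite e_pure [m in RHS](coord_vbasis (memvf m)) linear_sum.
by apply: eq_bigr => i _; rewrite c_pure !linearZ scale_lfunE.
Qed.

End ModuleTheory.

(** * Fitting's lemma and the corner algebra of a primitive idempotent *)

Section PrimitiveIdempotents.
Variables (k : fieldType) (A : falgType k) (M : module A).
Implicit Types e f h : 'End(M).

Definition lfun_exp f n : 'End(M) := iter n (fun h => f \o h)%VF \1%VF.

Lemma lfun_exp_hom f n : is_hom f -> is_hom (lfun_exp f n).
Proof.
by move=> hf; elim: n => [|n IHn]; [exact: id_hom | exact: comp_hom].
Qed.

Lemma lfun_expD f m n : lfun_exp f (m + n) = (lfun_exp f m \o lfun_exp f n)%VF.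
Proof. by elim: m => [|m IHm]; rewrite ?comp_lfun1l //= IHm comp_lfunA. Qed.

Lemma lfun_expSr f n : lfun_exp f n.+1 = (lfun_exp f n \o f)%VF.
Proof. by rewrite -addn1 lfun_expD /= comp_lfun1r. Qed.

Lemma lfun_exp_fixed f n x : f x = x -> lfun_exp f n x = x.
Proof.
by move=> fx; elim: n => [|n IHn]; rewrite ?id_lfunE //= comp_lfunE IHn.
Qed.

(** As long as image and kernel of a power meet, squaring that power shrinks the image. The exponent
    [n.+1] excludes the zeroth power, for which the claim is trivial. *)
Lemma fitting_exponent f :
  exists n, (limg (lfun_exp f n.+1) :&: lker (lfun_exp f n.+1) = 0)%VS.
Proof.
have [d] := ubnP (\dim (limg (lfun_exp f 1))); move: 0%N.
elim: d => // d IHd n; rewrite ltnS => le_d.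
(* Rank-nullity for the power restricted to its own image. *)
have ker_dim := limg_ker_dim (lfun_exp f n.+1) (limg (lfun_exp f n.+1)).
rewrite -limg_comp -lfun_expD addSn addnS -addSn in ker_dim.
have [cap0|ncap0] := eqVneq (\dim (limg (lfun_exp f n.+1)
    :&: lker (lfun_exp f n.+1))) 0%N.
  by exists n; apply/eqP; rewrite -dimv_eq0 cap0.
(* The index [n.+1 + n] stands for the exponent [2 * n.+1]. *)
apply: (IHd (n.+1 + n)%N); apply: leq_trans le_d.
by rewrite -ker_dim -[X in (X < _)%N]add0n ltn_add2r lt0n.
Qed.

(** [M] is the direct sum of image and kernel of a suitable power of [f]. Both are submodules, so
    the projection onto the image along the kernel is a morphism. *)
Lemma fitting_projection f : is_hom f -> exists n (q : 'End(M)),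
  [/\ is_hom q, (q \o q)%VF = q, forall x, q x \in limg (lfun_exp f n.+1),
      forall x, x \in limg (lfun_exp f n.+1) -> q x = x
    & forall x, x \in lker (lfun_exp f n.+1) <-> q x = 0].
Proof.
move=> hf; have [n cap0] := fitting_exponent f.
set F := lfun_exp f n.+1 in cap0 *; have hF : is_hom F by apply: lfun_exp_hom.
have capC0 : (lker F :&: limg F = 0)%VS by rewrite capvC.
have sum_full : (limg F + lker F)%VS = fullv.
  apply/eqP; rewrite eqEdim subvf dimv_disjoint_sum // addnC.
  by rewrite -[X in (X <= _)%N](limg_ker_dim F) leq_add2r dimvS // capvSr.
pose q := daddv_pi (limg F) (lker F); pose q' := daddv_pi (lker F) (limg F).
have qq' x : q x + q' x = x by apply: daddv_pi_add; rewrite // sum_full memvf.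
have qid x : x \in limg F -> q x = x by apply: daddv_pi_id.
have q0 x : x \in lker F -> q x = 0.
  by move=> kx; apply: (addIr (q' x)); rewrite qq' add0r /q' daddv_pi_id.
have Fq x : F (q x) = F x.
  rewrite -[in RHS](qq' x) linearD [X in _ + X](_ : _ = 0) ?addr0 //.
  by apply/eqP; rewrite -memv_ker memv_pi.
have limF a x : x \in limg F -> a ▷ x \in limg F.
  by case/memv_imgP=> y _ ->; rewrite -hF memv_img ?memvf.
have kerF a x : x \in lker F -> a ▷ x \in lker F.
  by rewrite !memv_ker hF => /eqP->; rewrite linear0.
exists n, q; split=> [a x||x|x|x].
- rewrite -[in LHS](qq' x) !linearD [X in _ + X = _]q0 ?addr0; last first.
    by apply: kerF; apply: memv_pi.
  by apply: qid; apply: limF; apply: memv_pi.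
- by apply/lfunP=> x; rewrite comp_lfunE /q daddv_pi_proj.
- exact: memv_pi.
- exact: qid.
split; first exact: q0.
by move=> qx; rewrite memv_ker -Fq qx linear0.
Qed.

Variable e : 'End(M).
Hypotheses (he : is_hom e) (ee : (e \o e)%VF = e).
Hypothesis e_prim : forall q : 'End(M), is_hom q -> (q \o q)%VF = q ->
  (e \o q)%VF = q -> (q \o e)%VF = q -> q = 0 \/ q = e.

(* An endomorphism [f] of the summand [e M] is extended to [M] by the identity
   on the complement, so that it is invertible on [e M] iff the extension is. *)
Definition extend f : 'End(M) := f + (\1%VF - e).

(** Membership in the corner algebra [e End_A(M) e], whose unit is [e]. *)
Definition corner f := [/\ is_hom f, (e \o f)%VF = f & (f \o e)%VF = f].

Lemma extend_hom f : is_hom f -> is_hom (extend f).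
Proof.
by move=> hf; do !apply: add_hom => //; [exact: id_hom | exact: opp_hom].
Qed.

Lemma extendE f x : extend f x = f x + (x - e x).
Proof. by rewrite !add_lfunE opp_lfunE id_lfunE. Qed.

(** [f x] lies in the image of [e] and [x - e x] in its kernel, so their sum vanishes only if both
    do. *)
Lemma extend_ker0 f x : corner f -> (extend f x = 0) <-> (f x = 0 /\ e x = x).
Proof.
case=> _ ef fe; rewrite extendE; split=> [fx0|[-> ->]]; last first.
  by rewrite subrr addr0.
have /(congr1 e) := fx0; rewrite linear0 linearD linearB /=.
rewrite -!(comp_lfunE e) ef ee subrr addr0 => fx.
by move: fx0; rewrite fx add0r => /eqP; rewrite subr_eq0 => /eqP.
Qed.

Lemma lker0_triv f : (forall x, f x = 0 -> x = 0) -> lker f == 0%VS.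
Proof.
move=> f0; rewrite -subv0; apply/subvP=> x.
by rewrite memv_ker memv0 => /eqP/f0->.
Qed.

Lemma extend_comm f :
  corner f -> (extend f \o e)%VF = f /\ (e \o extend f)%VF = f.
Proof.
case=> _ ef fe; rewrite /extend !(comp_lfunDl, comp_lfunDr).
rewrite comp_lfunNl comp_lfunNr.
by rewrite comp_lfun1l comp_lfun1r ee ef fe subrr addr0.
Qed.

Lemma corner_mulV f : corner f -> lker (extend f) == 0%VS ->
  (f \o (extend f)^-1)%VF = e.
Proof.
move=> cf kf; have [_ ef] := extend_comm cf.
by rewrite -{1}ef -comp_lfunA lker0_compfV // comp_lfun1r.
Qed.

Lemma extend_inv_comm f : corner f -> lker (extend f) == 0%VS ->
  ((extend f)^-1 \o e = e \o (extend f)^-1)%VF.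
Proof.
move=> cf kf; have [fe _] := extend_comm cf.
by rewrite -[RHS](lker0_compKf kf) [(extend f \o _)%VF]comp_lfunA fe corner_mulV.
Qed.

(** The Fitting projection of [f] is an idempotent of the corner. By primitivity it is [0], and [f]
    is nilpotent, or [e], and [f] is injective on [e M]. *)
Lemma corner_nilp_or_unit f : corner f ->
  (exists n, lfun_exp f n.+1 = 0) \/ lker (extend f) == 0%VS.
Proof.
move=> cf; have [hf ef fe] := cf.
have [n [q [hq qq qim qid qker]]] := fitting_projection hf.
have eF : (e \o lfun_exp f n.+1)%VF = lfun_exp f n.+1.
  by rewrite /= comp_lfunA ef.
have Fe : (lfun_exp f n.+1 \o e)%VF = lfun_exp f n.+1.
  by rewrite lfun_expSr -comp_lfunA fe.
have eq : (e \o q)%VF = q.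
  apply/lfunP=> x; rewrite comp_lfunE; have /memv_imgP[y _ ->] := qim x.
  by rewrite -comp_lfunE eF.
(* The power of [f] kills [e x - x], and [q] has the same kernel. *)
have qe : (q \o e)%VF = q.
  apply/lfunP=> x; apply/eqP; rewrite comp_lfunE -subr_eq0 -linearB; apply/eqP.
  by apply/qker; rewrite memv_ker linearB /= -comp_lfunE Fe subrr.
have [q0|q_e] := e_prim hq qq eq qe.
  left; exists n; apply/lfunP=> x; rewrite zero_lfunE; apply/eqP.
  by rewrite -memv_ker; apply/qker; rewrite q0 zero_lfunE.
right; apply: lker0_triv => x /(extend_ker0 _ cf)[fx0 <-].
by rewrite -q_e; apply/qker; rewrite memv_ker lfun_expSr comp_lfunE fx0 linear0.
Qed.

(** The corner is local: a finite sum is invertible only if some summand is. The induction splits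
    off the first summand. *)
Lemma corner_sum_unit n (f : 'I_n -> 'End(M)) : e != 0 ->
  (forall i, corner (f i)) -> lker (extend (\sum_i f i)) == 0%VS ->
  exists i, lker (extend (f i)) == 0%VS.
Proof.
move=> nz_e; elim: n f => [|n IHn] f cf.
  (* The empty sum extends to [1 - e], which kills every [e x]; injectivity would force [e = 0]. *)
  rewrite big_ord0 => /lker0P inj; case/eqP: nz_e; apply/lfunP=> x.
  rewrite zero_lfunE; apply: inj; rewrite linear0 extendE zero_lfunE add0r.
  by rewrite -comp_lfunE ee subrr.
rewrite big_ord_recl; set v := \sum_i _; set u := _ + v => ku.
have [hv ev ve] : corner v.
  split.
  - apply: (big_ind (@is_hom _ _ M M)) => [||i _]; first exact: zero_hom.
      exact: add_hom.
    by case: (cf (lift ord0 i)).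
  - apply/lfunP=> x; rewrite comp_lfunE sum_lfunE linear_sum.
    by apply: eq_bigr => i _; rewrite /= -comp_lfunE;
      case: (cf (lift ord0 i)) => _ -> _.
  - apply/lfunP=> x; rewrite comp_lfunE !sum_lfunE.
    by apply: eq_bigr => i _; rewrite /= -comp_lfunE;
      case: (cf (lift ord0 i)) => _ _ ->.
have cv : corner v by [].
have [hf0 ef0 f0e] := cf ord0.
have cu : corner u.
  by split; rewrite ?comp_lfunDr ?comp_lfunDl ?ef0 ?ev ?f0e ?ve //;
    apply: add_hom.
(* The first summand divided by the sum [u]: if [h] is invertible in the corner, so is [f ord0]; if
   it is nilpotent, the remaining sum [v] is invertible. *)
pose h := ((extend u)^-1 \o f ord0)%VF.
have ch : corner h.
  split.
  - apply: comp_hom => //; apply: inv_hom => //.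
    by apply: extend_hom; case: cu.
  - by rewrite comp_lfunA -extend_inv_comm // -comp_lfunA ef0.
  - by rewrite -comp_lfunA f0e.
have [[m hm0]|kh] := corner_nilp_or_unit ch.
  have [|i ki] := IHn (fun i => f (lift ord0 i)) (fun i => cf _).
    apply: lker0_triv => x /(extend_ker0 _ cv)[vx ex].
    (* On [e M], [v x = 0] gives [u x = f ord0 x], so [h] fixes [x], and nilpotency yields
       [x = 0]. *)
    have hx : h x = x.
      rewrite comp_lfunE -[RHS](lker0_lfunK ku) extendE ex subrr addr0.
      by rewrite add_lfunE vx addr0.
    by rewrite -(lfun_exp_fixed m.+1 hx) hm0 zero_lfunE.
  by exists (lift ord0 i).
exists ord0; apply: lker0_triv => x /(extend_ker0 _ (cf ord0))[f0x ex].
have /lker0P inj := kh; apply: inj; rewrite linear0.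
by apply/(extend_ker0 _ ch); split; rewrite // comp_lfunE f0x linear0.
Qed.

Lemma primitive_factor : e != 0 -> projective M ->
  exists (p : 'Hom(M, regular_mod A)) (j : 'Hom(regular_mod A, M)),
    [/\ is_hom p, is_hom j, (j \o p)%VF = e, (p \o e)%VF = p & (e \o j)%VF = j].
Proof.
move=> nz_e /projective_sum_id[n [p [j [hp hj jp]]]].
pose f i : 'End(M) := (e \o j i \o p i \o e)%VF.
have cf i : corner (f i).
  split; first by do !apply: comp_hom.
    by rewrite /f -!comp_lfunA (comp_lfunA e e) ee.
  by rewrite /f -!comp_lfunA ee.
have sum_f : \sum_i f i = e.
  apply/lfunP=> x; rewrite -[in RHS]ee comp_lfunE -[e x in RHS]id_lfunE -jp.
  rewrite !sum_lfunE linear_sum; apply: eq_bigr => i _.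
  by rewrite !comp_lfunE.
have [|i ki] := corner_sum_unit nz_e cf.
  by rewrite sum_f /extend addrC subrK; apply: lker0_triv => x; rewrite id_lfunE.
(* The inverse of [f i] in the corner; absorbing it into [p] makes [j \o p] equal to [e]. *)
pose f' := ((extend (f i))^-1 \o e)%VF.
exists (p i \o e \o f')%VF, (e \o j i)%VF; split.
- do !apply: comp_hom => //; apply: inv_hom => //.
  by apply: extend_hom; case: (cf i).
- exact: comp_hom.
- transitivity (f i \o f')%VF; first by rewrite !comp_lfunA.
  by rewrite /f' comp_lfunA corner_mulV.
- by rewrite /f' -!comp_lfunA ee.
by rewrite comp_lfunA ee.
Qed.

End PrimitiveIdempotents.

(** * Decomposition of a projective module into summands of the regular module *)

Section SummandDecomposition.
Variables (k : fieldType) (A : falgType k) (M : module A).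
Hypothesis projM : projective M.

(** A decomposition of the summand [e M]. The last two clauses confine the maps to [e M], so that
    decompositions for orthogonal idempotents can be concatenated. *)
Definition idem_decomposition (e : 'End(M)) :=
  exists n (p : 'I_n -> 'Hom(M, regular_mod A))
           (j : 'I_n -> 'Hom(regular_mod A, M)),
    [/\ (forall i, is_hom (p i)) /\ (forall i, is_hom (j i)),
        \sum_i (j i \o p i)%VF = e,
        forall l m, (p l \o j m)%VF = (p l \o j l)%VF *+ (l == m),
        forall i, (p i \o e)%VF = p i
      & forall i, (e \o j i)%VF = j i].

(** The mixed products vanish: [p l] factors through [e] and [j' m] through [e'], and likewise with
    the roles exchanged. *)
Lemma idem_decomposition_add (e e' : 'End(M)) :
  (e \o e')%VF = 0 -> (e' \o e)%VF = 0 ->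
  idem_decomposition e -> idem_decomposition e' ->
  idem_decomposition (e + e').
Proof.
move=> ee'0 e'e0 [n [p [j [[hp hj] jp pj pe ej]]]].
move=> [n' [p' [j' [[hp' hj'] jp' pj' pe' ej']]]].
have pe'0 i : (p i \o e' = 0)%VF by rewrite -pe -comp_lfunA ee'0 comp_lfun0r.
have p'e0 i : (p' i \o e = 0)%VF by rewrite -pe' -comp_lfunA e'e0 comp_lfun0r.
exists (n + n')%N.
exists (fun i => match split i with inl i => p i | inr i => p' i end).
exists (fun i => match split i with inl i => j i | inr i => j' i end).
split=> [|||i|i].
- by split=> i; case: splitP.
- rewrite big_split_ord /= -jp -jp'; congr (_ + _); apply: eq_bigr => i _.
    by rewrite (unsplitK (inl i)).
  by rewrite (unsplitK (inr i)).
- move=> l m; case: (split_ordP l) => l' ->; case: (split_ordP m) => m' ->.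
  + by rewrite eq_lshift pj.
  + by rewrite eq_lrshift -ej' comp_lfunA pe'0 comp_lfun0l.
  + by rewrite eq_rlshift -ej comp_lfunA p'e0 comp_lfun0l.
  + by rewrite eq_rshift pj'.
- by case: splitP => i' _; rewrite comp_lfunDr ?pe ?pe' ?pe'0 ?p'e0 ?addr0 ?add0r.
case: splitP => i' _; rewrite comp_lfunDl.
  by rewrite ej -{2}ej comp_lfunA e'e0 comp_lfun0l addr0.
by rewrite ej' -{1}ej' comp_lfunA ee'0 comp_lfun0l add0r.
Qed.

(** The idempotent [q] fixes its image. If this were all of the image of [e], then [q \o e = e],
    that is [q = e]. *)
Lemma sub_idem_dim (e q : 'End(M)) :
  (e \o q)%VF = q -> (q \o q)%VF = q -> (q \o e)%VF = q -> q <> e ->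
  (\dim (limg q) < \dim (limg e))%N.
Proof.
move=> eq qq qe q_neq_e.
have sub : (limg q <= limg e)%VS.
  by rewrite -eq limg_comp limgS // subvf.
rewrite (ltn_leqif (dimv_leqif_sup sub)); apply/negP=> sub'.
apply: q_neq_e; rewrite -qe; apply/lfunP=> x; rewrite comp_lfunE.
have /(subvP sub')/memv_imgP[y _ ->] : e x \in limg e by rewrite memv_img ?memvf.
by rewrite -comp_lfunE qq.
Qed.

Lemma idem_decompositionP (e : 'End(M)) :
  is_hom e -> (e \o e)%VF = e -> idem_decomposition e.
Proof.
have [d] := ubnP (\dim (limg e)).
elim: d e => // d IHd e; rewrite ltnS => le_d he ee.
have [->|nz_e] := eqVneq e 0.
  exists 0%N, (fun _ => 0), (fun _ => 0).
  by split=> [||[]|[]|[]] //; [split; case | rewrite big_ord0].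
pose splits (q : 'End(M)) := [/\ is_hom q, (q \o q)%VF = q,
  (e \o q)%VF = q, (q \o e)%VF = q & q <> 0 /\ q <> e].
(* Either some [q] splits [e] into [q] and [e - q], both of smaller rank, or [e] is primitive. *)
have [[q [hq qq eq qe [nz_q q_neq_e]]]|prim] := classic (exists q, splits q).
  have -> : e = q + (e - q) by rewrite addrC subrK.
  have hq' : is_hom (e - q) by apply: add_hom => //; apply: opp_hom.
  have qq' : (q \o (e - q) = 0)%VF.
    by rewrite comp_lfunDr comp_lfunNr qe qq subrr.
  have q'q : ((e - q) \o q = 0)%VF.
    by rewrite comp_lfunDl comp_lfunNl eq qq subrr.
  have q'q' : ((e - q) \o (e - q) = e - q)%VF.
    rewrite comp_lfunDr comp_lfunNr q'q subr0 comp_lfunDl comp_lfunNl.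
    by rewrite ee qe.
  apply: idem_decomposition_add => //; apply: IHd => //; apply: leq_trans le_d.
    exact: sub_idem_dim.
  apply: sub_idem_dim => //.
  - by rewrite comp_lfunDr comp_lfunNr ee eq.
  - by rewrite comp_lfunDl comp_lfunNl ee qe.
  - by move=> /eqP; rewrite subr_eq addrC -subr_eq subrr eq_sym => /eqP.
have e_prim (q : 'End(M)) : is_hom q -> (q \o q)%VF = q ->
    (e \o q)%VF = q -> (q \o e)%VF = q -> q = 0 \/ q = e.
  move=> hq qq eq qe; apply: NNPP => nq; apply: prim.
  by exists q; split=> //; split=> ?; apply: nq; [left | right].
have [p [j [hp hj jp pe ej]]] := primitive_factor he ee e_prim nz_e projM.
exists 1%N, (fun _ => p), (fun _ => j).
by split=> // [|l m]; rewrite ?big_ord1 // !ord1 eqxx.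
Qed.

End SummandDecomposition.

(** * Pullback of modified traces and the explicit formula *)

Lemma trace_sum (k : fieldType) (A : quasiHopf k) (I : module A -> Prop)
    (t : forall X : module A, 'End(X) -> k) (X : module A) n
    (f : 'I_n -> 'End(X)) :
  cyclic_trace I t -> I X -> (forall i, is_hom (f i)) ->
  t X (\sum_i f i) = \sum_i t X (f i).
Proof.
move=> [tlin _] IX; have h0 := @zero_hom _ _ X X.
elim: n f => [|n IHn] f hf.
  (* Linearity at [1 *: 0 + 0] gives [t 0 = t 0 + t 0], hence [t 0 = 0]. *)
  rewrite !big_ord0; have := tlin X IX 1 0 0 h0 h0.
  by rewrite scale1r addr0 mul1r -[LHS]addr0 => /addrI.
rewrite !big_ord_recl -[f ord0]scale1r tlin // ?mul1r ?scale1r ?IHn //.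
by apply: (big_ind (@is_hom _ _ X X)) => // ; exact: add_hom.
Qed.

Section RestrictedTrace.
Variables (k : fieldType) (H : quasiHopf k) (A : subQuasiHopf H) (g : H).
Hypothesis gA : g \in sq_alg A.
Local Notation B := (rs_quasiHopf A).
Local Notation R := (@res_mod k H A).
Variable t : forall X : module B, 'End(X) -> k.

Lemma res_retract_closed :
  retract_closed (@projective k B) -> retract_closed (projective_over A).
Proof.
by move=> rc X Y i p hi hp pi; apply: rc (res_hom hi) (res_hom hp) pi.
Qed.

Lemma res_tens_projective (X V : module H) :
  retract_closed (@projective k B) ->
  projective (tens_mod (R X) (R V)) -> projective_over A (tens_mod X V).
Proof.
move=> rc; apply: rc (@res_tens_hom _ _ A X V) (@tens_res_hom _ _ A X V) _.
exact: comp_lfun1l.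
Qed.

Lemma res_cyclic_trace :
  cyclic_trace (@projective k B) t ->
  cyclic_trace (projective_over A) (res_trace t).
Proof.
case=> tlin tcyc; split=> [X pX c f f' hf hf'|X Y pX pY f f' hf hf'].
  by apply: tlin => //; apply: res_hom.
exact: (tcyc (R X) (R Y) pX pY f f' (res_hom hf) (res_hom hf')).
Qed.

(** A trace may a priori differ on two modules with the same space. Cyclicity, applied to [f] viewed
    as a map between them and to the identity isomorphism, makes the values agree. *)
Lemma res_trace_tens (X V : module H) (f : 'End(tens_mod X V)) :
  retract_closed (@projective k B) -> cyclic_trace (@projective k B) t ->
  projective (tens_mod (R X) (R V)) -> is_hom f ->
  res_trace t f = t (f : 'End(tens_mod (R X) (R V))).
Proof.
move=> rc [_ tcyc] pXV hf; have pXV' := res_tens_projective rc pXV.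
have hf' : is_hom (f : 'Hom(R (tens_mod X V), tens_mod (R X) (R V))).
  by move=> a x; rewrite res_actE hf tens_res_actE res_actE.
have := tcyc _ _ pXV' pXV _ _ hf' (@tens_res_hom _ _ A X V).
by rewrite [in LHS]comp_lfun1l [in RHS]comp_lfun1r.
Qed.

Lemma tens_hom_res (X V : module H) (f : 'End(tens_mod X V)) :
  is_hom f -> is_hom (f : 'End(tens_mod (R X) (R V))).
Proof. by move=> hf a x; rewrite !tens_res_actE !res_actE hf. Qed.

Lemma res_right_modified_trace :
  right_modified_trace (to_sub A g) (@projective _ _) t ->
  right_modified_trace g (projective_over A) (res_trace t).
Proof.
case=> [[rc tid] tcyc tptr].
split; [split | exact: res_cyclic_trace |]; first exact: res_retract_closed.
  by move=> X V pX; apply: res_tens_projective => //; apply: tid.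
move=> X V pX f hf; rewrite res_trace_tens //; last exact: tid.
by rewrite tptr //; [rewrite right_ptr_res | exact: tens_hom_res].
Qed.

Lemma res_left_modified_trace :
  left_modified_trace (to_sub A g) (@projective _ _) t ->
  left_modified_trace g (projective_over A) (res_trace t).
Proof.
case=> [[rc tid] tcyc tptr].
split; [split | exact: res_cyclic_trace |]; first exact: res_retract_closed.
  by move=> X V pX; apply: res_tens_projective => //; apply: tid.
move=> V X pX f hf; rewrite res_trace_tens //; last exact: tid.
by rewrite tptr //; [rewrite left_ptr_res | exact: tens_hom_res].
Qed.

Lemma res_trace_formulaP (l : 'Hom(B, k^o)) :
  cyclic_trace (@projective k B) t -> corresponds l t -> res_trace_formula l t.
Proof.
move=> tcyc_t lt M pM; split.
  have [|n [p [j [[hp hj] jp pj _ _]]]] := idem_decompositionP pM (@id_hom _ _ _).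
    exact: comp_lfun1l.
  by exists n, p, j; split.
move=> n p j [hp hj jp _] f hfH.
have hf : is_hom (f : 'End(R M)) by apply: res_hom.
have fjp : f = \sum_i (f \o j i \o p i)%VF.
  apply/lfunP=> x; rewrite sum_lfunE -[x in LHS](@id_lfunE _ (R M)) -jp.
  by rewrite sum_lfunE linear_sum; apply: eq_bigr => i _; rewrite !comp_lfunE.
rewrite /res_trace {1}fjp (trace_sum tcyc_t) // => [|i]; last first.
  exact: comp_hom (comp_hom hf (hj i)) (hp i).
apply: eq_bigr => i _.
have hfj := comp_hom hf (hj i).
rewrite -(tcyc_t.2 _ _ (@regular_projective _ _) pM _ _ hfj (hp i)).
(* The regular module is a summand of itself through the identity, so [corresponds] evaluates the
   trace there. *)
have h1 := @id_hom _ _ (regular_mod B).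
rewrite (lt _ _ _ h1 h1 (comp_lfun1l _) _ (comp_hom (hp i) hfj)).
by rewrite comp_lfun1l comp_lfun1r comp_lfunA.
Qed.

End RestrictedTrace.

Theorem corollary4p6 (k : closedFieldType) (H : quasiHopf k) (g : H)
    (A : subQuasiHopf H) (pivot_g : is_pivot g) (gA : g \in sq_alg A)
    (unimodA : unimodular (rs_quasiHopf A)) :
  (forall (l : 'Hom(rs_quasiHopf A, k^o))
     (t : forall X : module (rs_quasiHopf A), 'End(X) -> k),
     right_sym_cointegral (to_sub A g) l ->
     right_modified_trace (to_sub A g) (@projective _ _) t ->
     corresponds l t ->
     right_modified_trace g (projective_over A) (res_trace t)
     /\ res_trace_formula l t)
  /\
  (forall (l : 'Hom(rs_quasiHopf A, k^o))
     (t : forall X : module (rs_quasiHopf A), 'End(X) -> k),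
     left_sym_cointegral (to_sub A g) l ->
     left_modified_trace (to_sub A g) (@projective _ _) t ->
     corresponds l t ->
     left_modified_trace g (projective_over A) (res_trace t)
     /\ res_trace_formula l t).
Proof.
by split=> l t _ mt lt; split;
  [exact: res_right_modified_trace | apply: res_trace_formulaP (rmt_cyclic mt) lt
  |exact: res_left_modified_trace | apply: res_trace_formulaP (lmt_cyclic mt) lt].
Qed.
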